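(* Let $p$ be fixed and consider the setting, notation and estimators described in the context. Assume that $(\mathbf X_i^\top,\mathbf A_i^\top)^\top$, $i=1,\dots,n$, are independent and identically distributed as $(\mathbf X^\top,\mathbf A^\top)^\top$, that $\mathbf A$ has finite fourth moments, that $\mathbf X=(1,\mathbf W^\top)^\top$ has finite eighth moments, and that $\mathrm C^\sigma=\mathbb E[\operatorname{v}(\mathbf X)\operatorname{v}(\mathbf X)^\top]$ is positive definite. Suppose that $\sqrt n(\widehat\mu_n-\mu^* )=\mathcal O_{\mathbb P}(1)$, $\sqrt n(\widehat\sigma_n^{\,\mathrm{init}}-\sigma^* )=\mathcal O_{\mathbb P}(1)$, and that $\lambda_n^\sigma\to0$, $\sqrt n\,\lambda_n^\sigma\to0$, $n\,\lambda_n^\sigma\to\infty$. Suppose further that the covariance matrix of the random coefficients has the form $$\Sigma^*=\begin{bmatrix}\Sigma_1^*&\mathbf 0_{d\times(p-d)}\\ \mathbf 0_{(p-d)\times d}&\mathbf 0_{(p-d)\times(p-d)}\end{bmatrix}$$ for a positive definite $d\times d$ matrix $\Sigma_1^*$. Then $$\mathbb P\big(\widehat\sigma^{\,\mathrm{AL}}_{n,\mathrm{pos}}=\widehat\sigma^{\,\mathrm{AL}}_n\big)\to1,\qquad n\to\infty.$$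
   Context: Model: $Y_i=\mathbf X_i^\top\mathbf A_i$, $i=1,\dots,n$, with $\mathbf X_i=(1,\mathbf W_i^\top)^\top\in\mathbb R^p$; $\mathbf A_i\in\mathbb R^p$ are unobserved random coefficients, $\mathbf X_i$ and $\mathbf A_i$ are independent, and the observations are $(Y_i,\mathbf W_i^\top)^\top$. Put $\mu^*=\mathbb E[\mathbf A]$, $\Sigma^*=\operatorname{Cov}(\mathbf A)$. Half-vectorization of a symmetric $M\in\mathbb R^{p\times p}$: $\operatorname{vec}(M)=(M_{11},\dots,M_{pp},M_{12},\dots,M_{1p},M_{23},\dots,M_{2p},\dots,M_{(p-1)p})^\top\in\mathbb R^{p(p+1)/2}$. For $\mathbf x\in\mathbb R^p$: $\operatorname{v}(\mathbf x)=(x_1^2,\dots,x_p^2,2x_1x_2,\dots,2x_1x_p,2x_2x_3,\dots,2x_2x_p,\dots,2x_{p-1}x_p)^\top$. Set $\sigma^*=\operatorname{vec}(\Sigma^* )$. Given an estimator $\widehat\mu_n$ of $\mu^*$ let $\mathbb Y_n^\sigma=\big((Y_1-\mathbf X_1^\top\widehat\mu_n)^2,\dots,(Y_n-\mathbf X_n^\top\widehat\mu_n)^2\big)^\top$ and $\mathbb X_n^\sigma=[\operatorname{v}(\mathbf X_1),\dots,\operatorname{v}(\mathbf X_n)]^\top$. With an initial estimator $\widehat\sigma_n^{\,\mathrm{init}}\in\mathbb R^{p(p+1)/2}$ of $\sigma^*$ and regularization parameter $\lambda_n^\sigma>0$ consider the objective $$Q_n(\beta)=\frac1n\|\mathbb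 Y_n^\sigma-\mathbb X_n^\sigma\beta\|_2^2+2\lambda_n^\sigma\sum_{k=1}^{p(p+1)/2}\frac{|\beta_k|}{|\widehat\sigma^{\,\mathrm{init}}_{n,k}|},$$ where $\beta_k=0$ is required if $\widehat\sigma^{\,\mathrm{init}}_{n,k}=0$. The (unconstrained) adaptive LASSO is any $\widehat\sigma_n^{\,\mathrm{AL}}\in\arg\min_{\beta\in\mathbb R^{p(p+1)/2}}Q_n(\beta)$, and the positive semi-definite version is any $\widehat\sigma_{n,\mathrm{pos}}^{\,\mathrm{AL}}\in\arg\min_{\beta\in\mathbb V_p^+}Q_n(\beta)$, where $\mathbb V_p^+=\{\operatorname{vec}(M): M\in\mathbb R^{p\times p}\text{ symmetric and positive semi-definite}\}$. *)

(* Defs.v *)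
From HB Require Import structures.
From mathcomp Require Import all_boot all_order all_algebra.
From mathcomp Require Import all_classical all_reals all_analysis.

Set Implicit Arguments.
Unset Strict Implicit.
Unset Printing Implicit Defensive.
Import Order.TTheory GRing.Theory Num.Theory.
Import numFieldNormedType.Exports.

Local Open Scope classical_set_scope.
Local Open Scope ring_scope.

Section LinearAlgebra.
Context {R : realType}.

Definition col_of_tuple (p : nat) (t : p.-tuple R) : 'cV[R]_p :=
  \col_k tnth t k.

Definition norm2 (p : nat) (u : 'cV[R]_p) : R :=
  Num.sqrt (\sum_k u k 0 ^+ 2).

Definition psdmx (p : nat) (M : 'M[R]_p) : Prop :=
  M^T = M /\ forall u : 'cV[R]_p, 0 <= (u^T *m M *m u) 0 0.

Definition pdmx (p : nat) (M : 'M[R]_p) : Prop :=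
  M^T = M /\ forall u : 'cV[R]_p, u != 0 -> 0 < (u^T *m M *m u) 0 0.

Definition argmin (T : Type) (S : set T) (f : T -> R) : set T :=
  [set b | S b /\ forall b', S b' -> f b <= f b'].

End LinearAlgebra.

Section HalfVectorization.

Definition hdim (p : nat) : nat := (p * p.+1)./2.

(* The order of the coordinates of a half-vectorization: first the diagonal,
   then the strict upper triangle row by row. *)
Definition hpairs (p : nat) : seq ('I_p * 'I_p) :=
  [seq (i, i) | i <- enum 'I_p] ++
  [seq (i, j) | i : 'I_p <- enum 'I_p,
                j : 'I_p <- [seq j : 'I_p <- enum 'I_p | (i < j)%N]].

Lemma size_hpairs (p : nat) : size (hpairs p) == hdim p.
Proof.
rewrite /hpairs size_cat size_map size_allpairs_dep size_enum_ord.
have szf (i : 'I_p) : size [seq j : 'I_p <- enum 'I_p | (i < j)%N] = (p - i.+1)%N.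
  rewrite size_filter -(count_map (@nat_of_ord p) (fun j => i < j)%N).
  rewrite val_enum_ord.
  have le_ip : (i.+1 <= p)%N by [].
  rewrite -[X in iota 0 X](subnKC le_ip) iotaD count_cat add0n.
  have /eqP -> : count (fun j => i < j)%N (iota 0 i.+1) == 0%N.
    rewrite -leqn0 leqNgt -has_count -all_predC; apply/allP => j.
    by rewrite mem_iota add0n /= ltnS -leqNgt.
  rewrite add0n -[RHS](size_iota i.+1); apply/eqP; rewrite -all_count.
  by apply/allP => j; rewrite mem_iota => /andP[].
have -> : [seq size [seq j : 'I_p <- enum 'I_p | (i < j)%N] | i : 'I_p <- enum 'I_p]
        = [seq (p - i.+1)%N | i <- iota 0 p].
  by rewrite -val_enum_ord -map_comp; apply: eq_map => i; exact: szf.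
have -> : sumn [seq (p - i.+1)%N | i <- iota 0 p] = 'C(p, 2).
  rewrite sumnE big_map -/(index_iota 0 p) -bin2_sum.
  rewrite [RHS]big_nat_rev /index_iota subn0; apply: eq_bigr => i _.
  by rewrite add0n.
by rewrite /hdim mulnC -[(p.+1 * p)%N]/(p.+1 * p.+1.-1)%N -bin2 binS bin1 addnC.
Qed.

Definition hpair (p : nat) (k : 'I_(hdim p)) : 'I_p * 'I_p :=
  tnth (Tuple (size_hpairs p)) k.

Context {R : realType}.

Definition vech (p : nat) (M : 'M[R]_p) : 'cV[R]_(hdim p) :=
  \col_k M (hpair k).1 (hpair k).2.

Definition vquad (p : nat) (x : 'cV[R]_p) : 'cV[R]_(hdim p) :=
  \col_k (let: (i, j) := hpair k in
          if i == j then x i 0 ^+ 2 else 2 * x i 0 * x j 0).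

Definition psd_vech (p : nat) : set 'cV[R]_(hdim p) :=
  [set vech M | M in [set M : 'M[R]_p | psdmx M]].

End HalfVectorization.
Arguments psd_vech : clear implicits.

Section Probability.
Context {d : measure_display} {T : measurableType d} {R : realType}.
Variable P : probability T R.

Definition indep2 d1 d2 (T1 : measurableType d1) (T2 : measurableType d2)
    (X : T -> T1) (Y : T -> T2) : Prop :=
  forall (B : set T1) (C : set T2), measurable B -> measurable C ->
    P (X @^-1` B `&` Y @^-1` C) = (P (X @^-1` B) * P (Y @^-1` C))%E.

Definition indep_seq d1 (T1 : measurableType d1) (Z : nat -> T -> T1) : Prop :=
  forall (J : seq nat) (B : nat -> set T1), uniq J ->
    (forall i, measurable (B i)) ->
    P (\bigcap_(i in [set` J]) (Z i @^-1` B i)) =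
    (\prod_(i <- J) P (Z i @^-1` B i))%E.

Definition same_law d1 (T1 : measurableType d1) (Z Z' : T -> T1) : Prop :=
  forall B : set T1, measurable B -> P (Z @^-1` B) = P (Z' @^-1` B).

(* Z_n = O_P(1) *)
Definition bounded_in_prob (k : nat) (Z : nat -> T -> 'cV[R]_k) : Prop :=
  forall eps : R, 0 < eps -> exists M : R,
    \forall n \near \oo, (P [set w | (M < norm2 (Z n w))%R] <= eps%:E)%E.

Definition finite_moment (r : nat) (p : nat) (Z : T -> p.-tuple R) : Prop :=
  forall k : 'I_p, ('E_P[(fun w => `|tnth (Z w) k| ^+ r)%R] < +oo)%E.

Definition mean_vec (p : nat) (A : T -> p.-tuple R) : 'cV[R]_p :=
  \col_k fine 'E_P[fun w => tnth (A w) k].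

Definition cov_mx (p : nat) (A : T -> p.-tuple R) : 'M[R]_p :=
  \matrix_(j, k) fine (covariance P (fun w => tnth (A w) j)
                                    (fun w => tnth (A w) k)).

(* E [v(X) v(X)^T] *)
Definition vquad_gram (p : nat) (X : T -> p.-tuple R) : 'M[R]_(hdim p) :=
  \matrix_(k, l) fine 'E_P[fun w =>
    vquad (col_of_tuple (X w)) k 0 * vquad (col_of_tuple (X w)) l 0].

End Probability.

(* One observation is a pair (y, w) with w in R^q; the intercept is prepended
   to w, so that the covariate vector lives in R^p with p = q.+1. *)
Notation obs R q := (R * q.-tuple R)%type.

Section AdaptiveLasso.
Context {R : realType} {q : nat}.

Definition with_intercept (w : q.-tuple R) : q.+1.-tuple R := cons_tuple 1 w.
Definition covariates (w : q.-tuple R) : 'cV[R]_q.+1 :=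
  col_of_tuple (with_intercept w).

Definition Ysigma n (s : n.-tuple (obs R q)) (mu : 'cV[R]_q.+1)
    : 'cV[R]_n :=
  \col_i ((tnth s i).1 - ((covariates (tnth s i).2)^T *m mu) 0 0) ^+ 2.

Definition Xsigma n (s : n.-tuple (obs R q))
    : 'M[R]_(n, hdim q.+1) :=
  \matrix_(i, k) vquad (covariates (tnth s i).2) k 0.

Definition lasso_objective n (s : n.-tuple (obs R q))
    (mu : 'cV[R]_q.+1) (init : 'cV[R]_(hdim q.+1)) (lam : R)
    (b : 'cV[R]_(hdim q.+1)) : R :=
  n%:R^-1 * norm2 (Ysigma s mu - Xsigma s *m b) ^+ 2
  + 2 * lam * \sum_k (`|b k 0| / `|init k 0|).

(* Where init vanishes, b must vanish too; the corresponding penalty term is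
   then 0 because x / 0 = 0. *)
Definition lasso_domain (init : 'cV[R]_(hdim q.+1)) : set 'cV[R]_(hdim q.+1) :=
  [set b | forall k, init k 0 = 0 -> b k 0 = 0].

Definition adaptive_lasso n (s : n.-tuple (obs R q))
    (mu : 'cV[R]_q.+1) (init : 'cV[R]_(hdim q.+1)) (lam : R)
    : set 'cV[R]_(hdim q.+1) :=
  argmin (lasso_domain init) (lasso_objective s mu init lam).

Definition adaptive_lasso_psd n (s : n.-tuple (obs R q))
    (mu : 'cV[R]_q.+1) (init : 'cV[R]_(hdim q.+1)) (lam : R)
    : set 'cV[R]_(hdim q.+1) :=
  argmin (psd_vech R q.+1 `&` lasso_domain init)
         (lasso_objective s mu init lam).

Definition measurable_estimator (k : nat)
    (f : forall n, n.-tuple (obs R q) -> 'cV[R]_k) : Prop :=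
  forall n (j : 'I_k), measurable_fun setT (fun s => f n s j 0).

End AdaptiveLasso.

Section Model.
Context {T : Type} {R : realType} {q : nat}.

Definition response (W : T -> q.-tuple R) (A : T -> q.+1.-tuple R) (w : T) : R :=
  ((covariates (W w))^T *m col_of_tuple (A w)) 0 0.

Definition sample (W : nat -> T -> q.-tuple R) (A : nat -> T -> q.+1.-tuple R)
    (n : nat) (w : T) : n.-tuple (obs R q) :=
  [tuple (response (W i) (A i) w, W i w) | i < n].

End Model.

(* Main.v *)
Require Import Defs.
From HB Require Import structures.
From mathcomp Require Import all_boot all_order all_algebra.
From mathcomp Require Import all_classical all_reals all_analysis.
From mathcomp Require Import measurable_realfun.
From mathcomp Require Import ring lra.

Set Implicit Arguments.
Unset Strict Implicit.
Unset Printing Implicit Defensive.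
Import Order.TTheory GRing.Theory Num.Theory.
Import numFieldNormedType.Exports.

Local Open Scope classical_set_scope.
Local Open Scope ring_scope.

(** The unconstrained adaptive LASSO is root-n consistent and sets the inactive
    coordinates exactly to zero with probability tending to one.  Outside the
    upper left block the covariance matrix vanishes, so there the estimated
    matrix vanishes too, and on the block it is close to a positive definite
    matrix; the unconstrained estimate is then positive semi-definite, so it
    also solves the constrained problem.  As the sample Gram matrix is
    invertible with probability tending to one, the objective is strictly
    convex and the two estimates coincide.

    The deterministic part rewrites the objective around the target sigma as a
    penalized quadratic function of u = b - sigma, whose linear term is the
    score z and whose quadratic term is the sample Gram matrix G
    ([lasso_objectiveE]).  Let z, G - C and init - sigma be of order 1/sqrt n,
    where C is the population Gram matrix.  Comparing the minimizer with sigma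
    gives |u| = O(1/sqrt n) because sqrt n * lam -> 0
    ([penalized_quad_rate]).  If an inactive coordinate were non-zero, setting
    it to zero would raise the quadratic part by at most O(1/sqrt n) per unit
    and lower the penalty by lam / |init_k|, which is at least of order
    sqrt n * lam; since n * lam -> oo this is impossible
    ([penalized_quad_select]).  All vectors are measured in the l1 norm and
    all coefficients in the maximum norm, and positive definiteness enters as
    a lower bound c |u|^2 on the quadratic form ([pdmx_coercive]).

    The probabilistic part shows that z and G - C are O_P(1/sqrt n).  The
    squared residual is a polynomial in X, A - E A and the error of the mean
    estimator ([residual_expansion]), so that G and z are combinations of
    averages of monomials in (X, A).  Those monomials are square integrable by
    the assumptions on the moments and by independence of X and A, and an
    average of n independent copies of a square-integrable variable is within
    O_P(1/sqrt n) of its mean by Chebyshev's inequality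
    ([iid_average_bounded]).  The monomials of the score that are not
    multiplied by the error of the mean estimator are centred, since
    E[(A - E A)(A - E A)^T] is the covariance matrix ([noise_rate]). *)

(** * Independence and integrals of products *)

Section Independence.
Context {d : measure_display} {T : measurableType d} {R : realType}.
Variable P : probability T R.

Lemma indep2_comp d1 d2 d3 d4 (T1 : measurableType d1) (T2 : measurableType d2)
    (T3 : measurableType d3) (T4 : measurableType d4)
    (X : T -> T1) (Y : T -> T2) (f : T1 -> T3) (g : T2 -> T4) :
  measurable_fun setT f -> measurable_fun setT g ->
  indep2 P X Y -> indep2 P (f \o X) (g \o Y).
Proof.
move=> mf mg XY B C mB mC; apply: (XY (f @^-1` B) (g @^-1` C)).
  by rewrite -[X in measurable X]setTI; exact: mf.
by rewrite -[X in measurable X]setTI; exact: mg.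
Qed.

(** The product rule on measurable rectangles says that the joint law of U and
    V is the product of their laws; the claim is then Fubini's theorem. *)
Lemma indep2_Rintegral (U V : T -> R) :
  measurable_fun setT U -> measurable_fun setT V -> indep2 P U V ->
  P.-integrable setT (EFin \o U) -> P.-integrable setT (EFin \o V) ->
  P.-integrable setT (EFin \o (U \* V)) /\
  \int[P]_w (U w * V w) = \int[P]_w U w * \int[P]_w V w.
Proof.
move=> mU mV UV iU iV.
have mUV : measurable_fun setT (fun w => (U w, V w)) by exact: measurable_fun_pair.
pose U' : {mfun T >-> R} := HB.pack U (isMeasurableFun.Build _ _ _ _ U mU).
pose V' : {mfun T >-> R} := HB.pack V (isMeasurableFun.Build _ _ _ _ V mV).
pose W : {mfun T >-> (R * R)%type} := HB.pack (fun w => (U w, V w))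
  (isMeasurableFun.Build _ _ _ _ (fun w => (U w, V w)) mUV).
pose m1 := distribution P U'; pose m2 := distribution P V'.
have lawE A : measurable A -> A `<=` setT -> (m1 \x m2)%E A = distribution P W A.
  move=> mA _; apply: product_measure_unique.
    by move=> B C mB mC; exact: UV.
  by [].
have mf : measurable_fun setT (fun z : R * R => (z.1 * z.2)%:E).
  apply/measurable_EFinP; exact: measurable_funM.
have i12 : (m1 \x m2)%E.-integrable setT (fun z : R * R => (z.1 * z.2)%:E).
  apply/integrable12ltyP => //=.
  under eq_integral => x _.
    under eq_integral => y _ do rewrite normrM EFinM.
    rewrite ge0_integralZl//; last by do 2 apply: measurableT_comp => //.
    over.
  rewrite /= ge0_integralZr//; last 2 first.
  - by do 2 apply: measurableT_comp => //.
  - exact: integral_ge0.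
  rewrite ge0_integral_distribution//; last by do 2 apply: measurableT_comp => //.
  rewrite ge0_integral_distribution//; last by do 2 apply: measurableT_comp => //.
  have normU0 : (0 <= \int[P]_w (`|U w|)%:E)%E by apply: integral_ge0.
  apply: lte_mul_pinfty => //.
  - by rewrite ge0_fin_numE//; case/integrableP: iU => _; exact.
  - by case/integrableP: iV => _; exact.
have iUV : P.-integrable setT (EFin \o (U \* V)).
  apply/integrableP; split.
    by apply/measurable_EFinP; exact: measurable_funM.
  case/integrableP : i12 => _.
  rewrite (eq_measure_integral (distribution P W) _)//.
  rewrite ge0_integral_distribution//; by apply: measurableT_comp.
split => //.
rewrite /Rintegral -fineM; [|exact: integrable_fin_num..].
congr fine.
rewrite -(@integral_distribution _ _ _ _ _ P W (fun z => (z.1 * z.2)%:E))//.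
rewrite -(eq_measure_integral _ lawE) -integral12_prod_meas1// /fubini_F.
rewrite -(@integral_distribution _ _ _ _ _ P U' EFin)// -/m1.
rewrite -(@integral_distribution _ _ _ _ _ P V' EFin)// -/m2.
under eq_integral => x _.
  under eq_integral => y _ do rewrite /= EFinM.
  rewrite integralZl//; last exact: integrable_pushforward.
  over.
rewrite /=.
have -> : (\int[m2]_x x%:E)%E = (fine (\int[m2]_x x%:E))%:E.
  rewrite fineK//; apply: integrable_fin_num => //; exact: integrable_pushforward.
rewrite integralZr //; exact: integrable_pushforward.
Qed.

End Independence.

(** * Square-integrable functions *)

Section SecondMoments.
Context {d : measure_display} {T : measurableType d} {R : realType}.
Variable P : probability T R.

Definition square_integrable (f : T -> R) : Prop :=
  measurable_fun setT f /\ P.-integrable setT (EFin \o (fun w => f w ^+ 2)).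

Lemma integrable_le (f g : T -> R) : measurable_fun setT f ->
  (forall w, `|f w| <= g w) -> P.-integrable setT (EFin \o g) ->
  P.-integrable setT (EFin \o f).
Proof.
move=> mf fg; apply: le_integrable => //; first exact/measurable_EFinP.
move=> w _ /=; rewrite lee_fin (le_trans (fg w))//; exact: ler_norm.
Qed.

Lemma square_integrable_mul (f g : T -> R) :
  square_integrable f -> square_integrable g ->
  P.-integrable setT (EFin \o (f \* g)).
Proof.
move=> [mf f2] [mg g2].
apply: (integrable_le _ _ (integrableD measurableT f2 g2)).
  exact: measurable_funM.
move=> w /=; rewrite normrM -[f w ^+ 2]real_normK ?num_real//.
rewrite -[g w ^+ 2]real_normK ?num_real//; nra.
Qed.

Lemma square_integrable_cst (c : R) : square_integrable (cst c).
Proof.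
split; first exact: measurable_cst.
exact: (finite_measure_integrable_cst P (c ^+ 2) measurableT).
Qed.

Lemma square_integrable_L1 (f : T -> R) : square_integrable f ->
  P.-integrable setT (EFin \o f).
Proof.
move=> f2; have := square_integrable_mul f2 (square_integrable_cst 1).
by apply: eq_integrable => // w _ /=; rewrite mulr1.
Qed.

Lemma square_integrableD (f g : T -> R) :
  square_integrable f -> square_integrable g -> square_integrable (f \+ g).
Proof.
move=> [mf f2] [mg g2]; split; first exact: measurable_funD.
apply: (integrable_le _ _ (integrableZl measurableT 2 (integrableD measurableT f2 g2))).
  by apply: measurable_funX; exact: measurable_funD.
move=> w /=; rewrite ger0_norm ?sqr_ge0//.
by have := sqr_ge0 (f w - g w); nra.
Qed.

Lemma square_integrableZ (c : R) (f : T -> R) :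
  square_integrable f -> square_integrable (fun w => c * f w).
Proof.
move=> [mf f2]; split; first exact: measurable_funM.
apply: eq_integrable (integrableZl measurableT (c ^+ 2) f2) => // w _ /=.
by rewrite -EFinM exprMn.
Qed.

Lemma square_integrable_sum (I : Type) (r : seq I) (f : I -> T -> R) :
  (forall i, square_integrable (f i)) ->
  square_integrable (fun w => \sum_(i <- r) f i w).
Proof.
move=> f2; elim: r => [|i r IH].
  have -> : (fun w => \sum_(i <- [::]) f i w) = cst 0.
    by apply/funext => w; rewrite big_nil.
  exact: square_integrable_cst.
have -> : (fun w => \sum_(j <- i :: r) f j w) =
    f i \+ (fun w => \sum_(j <- r) f j w).
  by apply/funext => w; rewrite big_cons.
exact: square_integrableD.
Qed.

Lemma Rintegral_sum (I : Type) (r : seq I) (f : I -> T -> R) :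
  (forall i, P.-integrable setT (EFin \o f i)) ->
  P.-integrable setT (EFin \o (fun w => \sum_(i <- r) f i w)) /\
  \int[P]_w (\sum_(i <- r) f i w) = \sum_(i <- r) \int[P]_w f i w.
Proof.
move=> fi; elim: r => [|i r [IH1 IH2]].
  split.
    apply: eq_integrable (finite_measure_integrable_cst P 0 measurableT) => //.
    by move=> w _ /=; rewrite big_nil.
  under eq_Rintegral do rewrite big_nil.
  by rewrite big_nil Rintegral_cst// mul0r.
split.
  apply: eq_integrable (integrableD measurableT (fi i) IH1) => //.
  by move=> w _ /=; rewrite big_cons.
under eq_Rintegral do rewrite big_cons.
by rewrite big_cons RintegralD// IH2.
Qed.

(** Orthogonality: expanding the square, only the n diagonal terms have a
    non-zero integral. *)
Lemma Rintegral_sqr_sum (n : nat) (g : nat -> T -> R) (V : R) :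
  (forall i, square_integrable (g i)) ->
  (forall i, \int[P]_w (g i w ^+ 2) = V) ->
  (forall i j, i != j -> \int[P]_w (g i w * g j w) = 0) ->
  \int[P]_w ((\sum_(i < n) g i w) ^+ 2) = n%:R * V.
Proof.
move=> g2 gV g0.
under eq_Rintegral => w _.
  rewrite expr2 mulr_suml.
  under eq_bigr do rewrite mulr_sumr.
  over.
have gg i j : P.-integrable setT (EFin \o (g i \* g j)).
  exact: square_integrable_mul.
rewrite (Rintegral_sum _ _).2 => [|i]; last by apply: (Rintegral_sum _ _).1 => j; exact: gg.
under eq_bigr => i _.
  rewrite (Rintegral_sum _ _).2 => [|j]; last exact: gg.
  rewrite (bigD1 i)//= big1 => [|j ji]; last by rewrite g0// eq_sym.
  rewrite addr0; under eq_Rintegral do rewrite -expr2.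
  rewrite gV; over.
by rewrite sumr_const card_ord mulr_natl.
Qed.

Lemma same_law_Rintegral d1 (T1 : measurableType d1) (X X' : T -> T1)
    (h : T1 -> R) :
  measurable_fun setT X -> measurable_fun setT X' -> same_law P X X' ->
  measurable_fun setT h -> P.-integrable setT (EFin \o (h \o X')) ->
  P.-integrable setT (EFin \o (h \o X)) /\
  \int[P]_w h (X w) = \int[P]_w h (X' w).
Proof.
move=> mX mX' XX' mh iX'.
pose Y : {mfun T >-> T1} := HB.pack X (isMeasurableFun.Build _ _ _ _ X mX).
pose Y' : {mfun T >-> T1} := HB.pack X' (isMeasurableFun.Build _ _ _ _ X' mX').
have law A : measurable A -> A `<=` setT -> distribution P Y A = distribution P Y' A.
  by move=> mA _; exact: XX'.
have mh' : measurable_fun setT (EFin \o h) by exact/measurable_EFinP.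
have iX : P.-integrable setT (EFin \o (h \o X)).
  apply/integrableP; split.
    by apply/measurable_EFinP; exact: measurableT_comp.
  move/integrableP : iX' => [_].
  have mah : measurable_fun setT (abse \o (EFin \o h)) by exact: measurableT_comp.
  rewrite -(@ge0_integral_distribution _ _ _ _ _ P Y' (abse \o (EFin \o h)))//;
    last by move=> y; exact: abse_ge0.
  rewrite -(@ge0_integral_distribution _ _ _ _ _ P Y (abse \o (EFin \o h)))//;
    last by move=> y; exact: abse_ge0.
  by rewrite (eq_measure_integral _ law).
split => //; congr fine.
rewrite -(@integral_distribution _ _ _ _ _ P Y' (EFin \o h))//.
rewrite -(@integral_distribution _ _ _ _ _ P Y (EFin \o h))//.
exact: eq_measure_integral.
Qed.

End SecondMoments.

(** * Boundedness in probability *)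

Section StochasticBoundedness.
Context {d : measure_display} {T : measurableType d} {R : realType}.
Variable P : probability T R.

(** Boundedness in probability of a real sequence.  The deviations are only
    required to lie in a small measurable set, so that sums, products and
    domination need no proof that the deviations themselves are measurable. *)
Definition stoch_bounded (f : nat -> T -> R) : Prop :=
  forall eps : R, 0 < eps -> exists M : R, \forall n \near \oo,
    exists E : set T, [/\ measurable E, (P (~` E) <= eps%:E)%E &
      forall w, E w -> `|f n w| <= M].

(** Both sequences are bounded off a set of measure at most eps, by splitting
    eps in two; the closure properties below follow. *)
Lemma stoch_bounded2 (f g h : nat -> T -> R) (F : R -> R -> R) :
  stoch_bounded f -> stoch_bounded g ->
  (forall a b, \forall n \near \oo, forall w, `|f n w| <= a -> `|g n w| <= b ->
     `|h n w| <= F a b) ->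
  stoch_bounded h.
Proof.
move=> bf bg fgh eps eps0; have eps20 : 0 < eps / 2 by rewrite divr_gt0.
have [a fa] := bf _ eps20; have [b gb] := bg _ eps20.
exists (F a b); have hab := fgh a b; near=> n.
have [E1 [mE1 PE1 fE1]] : exists E : set T, [/\ measurable E,
    (P (~` E) <= (eps / 2)%:E)%E & forall w, E w -> `|f n w| <= a].
  by near: n.
have [E2 [mE2 PE2 gE2]] : exists E : set T, [/\ measurable E,
    (P (~` E) <= (eps / 2)%:E)%E & forall w, E w -> `|g n w| <= b].
  by near: n.
exists (E1 `&` E2); split; first exact: measurableI.
  rewrite setCI (splitr eps) EFinD (le_trans (measureU2 _ _ _))//; last exact: leeD.
  - exact: measurableC.
  - exact: measurableC.
move=> w [E1w E2w]; have : forall w, `|f n w| <= a -> `|g n w| <= b ->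
    `|h n w| <= F a b by near: n.
by apply; [exact: fE1|exact: gE2].
Unshelve. all: by end_near. Qed.

Lemma stoch_bounded_le (f g : nat -> T -> R) : stoch_bounded g ->
  (\forall n \near \oo, forall w, `|f n w| <= `|g n w|) -> stoch_bounded f.
Proof.
move=> bg fg; apply: (@stoch_bounded2 g g f (fun a _ => a)) => // a b.
by apply: filterS fg => n fg w ga _; exact: le_trans (fg w) ga.
Qed.

Lemma stoch_boundedD (f g : nat -> T -> R) :
  stoch_bounded f -> stoch_bounded g -> stoch_bounded (fun n w => f n w + g n w).
Proof.
move=> bf bg; apply: (stoch_bounded2 (F := +%R) bf bg) => a b.
by near=> n => w fa gb; rewrite (le_trans (ler_normD _ _))// lerD.
Unshelve. all: by end_near. Qed.

Lemma stoch_boundedM (f g : nat -> T -> R) :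
  stoch_bounded f -> stoch_bounded g -> stoch_bounded (fun n w => f n w * g n w).
Proof.
move=> bf bg; apply: (stoch_bounded2 (F := *%R) bf bg) => a b.
by near=> n => w fa gb; rewrite normrM ler_pM.
Unshelve. all: by end_near. Qed.

Lemma stoch_bounded_cst (c : R) : stoch_bounded (fun _ _ => c).
Proof.
move=> eps eps0; exists `|c|; near=> n; exists setT; split => //.
by rewrite setCT measure0 lee_fin ltW.
Unshelve. all: by end_near. Qed.

Lemma stoch_bounded_norm (f : nat -> T -> R) :
  stoch_bounded f -> stoch_bounded (fun n w => `|f n w|).
Proof.
move=> bf; apply: (stoch_bounded_le bf).
by near=> n => w; rewrite normr_id.
Unshelve. all: by end_near. Qed.

Lemma stoch_bounded_sum (I : Type) (r : seq I) (f : I -> nat -> T -> R) :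
  (forall i, stoch_bounded (f i)) ->
  stoch_bounded (fun n w => \sum_(i <- r) f i n w).
Proof.
move=> bf; elim: r => [|i r IH].
  apply: (stoch_bounded_le (stoch_bounded_cst 0)).
  by near=> n => w; rewrite big_nil.
apply: (stoch_bounded_le (stoch_boundedD (bf i) IH)).
by near=> n => w; rewrite big_cons.
Unshelve. all: by end_near. Qed.

Lemma measurable_bool_set (g : T -> bool) :
  measurable_fun setT g -> measurable [set w | g w].
Proof. by move=> mg; rewrite -[X in measurable X]setTI; exact: (mg measurableT [set true]). Qed.

Lemma stoch_bounded_coord (k : nat) (Z : nat -> T -> 'cV[R]_k) (j : 'I_k) :
  (forall n i, measurable_fun setT (fun w => Z n w i 0)) ->
  bounded_in_prob P Z -> stoch_bounded (fun n w => Z n w j 0).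
Proof.
move=> mZ bZ eps eps0; have [M ZM] := bZ _ eps0; exists M.
apply: filterS ZM => n ZM.
have mN : measurable [set w | (M < norm2 (Z n w))%R].
  apply: measurable_bool_set; apply: measurable_fun_ltr => //.
  apply: measurableT_comp.
    by apply: continuous_measurable_fun; exact: sqrt_continuous.
  by apply: measurable_sum => i; exact: measurable_funX.
exists (~` [set w | (M < norm2 (Z n w))%R]); split.
- exact: measurableC.
- by rewrite setCK.
move=> w /=/negP; rewrite -leNgt; apply: le_trans.
rewrite -sqrtr_sqr; apply: ler_wsqrtr.
by rewrite (bigD1 j)//= lerDl; apply: sumr_ge0 => i _; exact: sqr_ge0.
Qed.

(** Chebyshev's inequality with a threshold that does not depend on n. *)
Lemma stoch_bounded_second_moment (Y : nat -> T -> R) (V : R) :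
  (\forall n \near \oo, square_integrable P (Y n) /\ \int[P]_w (Y n w ^+ 2) <= V) ->
  stoch_bounded Y.
Proof.
(* This threshold M satisfies 1 <= M and M * eps >= |V|, so V / M ^ 2 <= eps. *)
move=> YV eps eps0; exists (1 + `|V| / eps).
have M1 : 1 <= 1 + `|V| / eps by rewrite lerDl divr_ge0// ltW.
set M := 1 + _ in M1 *; have M0 : 0 < M by exact: lt_le_trans M1.
apply: filterS YV => n [[mY Y2] YV].
pose Y' : {mfun T >-> R} := HB.pack (Y n) (isMeasurableFun.Build _ _ _ _ (Y n) mY).
have mE : measurable [set w | (M%:E <= `|(Y n w)%:E|)%E].
  rewrite (_ : [set w | _] = [set w | M <= `|Y n w|]).
    apply: measurable_bool_set; apply: measurable_fun_ler => //.
    exact: measurableT_comp.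
  by apply/seteqP; split=> w /=; rewrite lee_fin.
exists (~` [set w | (M%:E <= `|(Y n w)%:E|)%E]); split.
- exact: measurableC.
- rewrite setCK.
  have := @markov _ _ _ P Y' (fun r => r ^+ 2) M M0.
  have -> : ('E_P[(fun r : R => (r ^+ 2)%R) \o (fun x : R => `|x|%R) \o Y'])%E =
      (\int[P]_w (Y n w ^+ 2))%:E.
    rewrite unlock /Rintegral fineK; last exact: integrable_fin_num.
    by apply: eq_integral => w _ /=; rewrite real_normK ?num_real.
  have PfinE : P [set w | (M%:E <= `|(Y n w)%:E|)%E] =
      (fine (P [set w | (M%:E <= `|(Y n w)%:E|)%E]))%:E.
    by rewrite fineK// fin_num_measure.
  rewrite PfinE -EFinM !lee_fin => /(_ _ _ _)/le_trans/(_ YV) MV.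
  have {}MV : M ^+ 2 * fine (P [set w | (M%:E <= `|(Y n w)%:E|)%E]) <= V.
    apply: MV => [|r _|a b a0 b0 ab]; [|exact: sqr_ge0|].
      by apply: measurable_funX; exact: measurable_id.
    by rewrite ler_pXn2r.
  have Meps : M * eps = eps + `|V| by rewrite /M mulrDl mul1r divfK ?gt_eqF.
  rewrite -(ler_pM2l (exprn_gt0 2 M0)) (le_trans MV)// expr2 -mulrA Meps.
  by have := ler_norm V; have := normr_ge0 V; nra.
move=> w /= /negP; rewrite lee_fin -ltNge; exact: ltW.
Qed.

(** The variance of an average of n pairwise independent copies is the variance
    of one copy divided by n. *)
Lemma iid_average_bounded d1 (T1 : measurableType d1) (Z : T -> T1)
    (Z_ : nat -> T -> T1) (h : T1 -> R) :
  measurable_fun setT Z -> (forall i, measurable_fun setT (Z_ i)) ->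
  (forall i, same_law P (Z_ i) Z) ->
  (forall i j, i != j -> indep2 P (Z_ i) (Z_ j)) ->
  measurable_fun setT h -> square_integrable P (h \o Z) ->
  stoch_bounded (fun n w => Num.sqrt n%:R *
    (n%:R^-1 * (\sum_(i < n) h (Z_ i w)) - \int[P]_w h (Z w))).
Proof.
move=> mZ mZ_ law ind mh h2.
set m := \int[P]_w h (Z w); pose g z := h z - m.
have mg : measurable_fun setT g by apply: measurable_funB.
have g2 : square_integrable P (g \o Z).
  exact: (square_integrableD h2 (square_integrable_cst P (- m))).
have mg2 : measurable_fun setT (fun z => g z ^+ 2) by exact: measurable_funX.
have gZ2 i : square_integrable P (g \o Z_ i).
  split; first exact: measurableT_comp.
  exact: (same_law_Rintegral (mZ_ i) mZ (law i) mg2 g2.2).1.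
have gZ0 i : \int[P]_w g (Z_ i w) = 0.
  rewrite (same_law_Rintegral (mZ_ i) mZ (law i) mg (square_integrable_L1 g2)).2.
  rewrite RintegralB//; last 2 first.
  - exact: square_integrable_L1.
  - exact: (finite_measure_integrable_cst P m measurableT).
  rewrite Rintegral_cst// (_ : fine _ = 1) ?mulr1 ?subrr//.
  exact: (congr1 fine (probability_setT P)).
have gS n : \int[P]_w ((\sum_(i < n) g (Z_ i w)) ^+ 2) =
    n%:R * \int[P]_w (g (Z w) ^+ 2).
  apply: (@Rintegral_sqr_sum _ _ _ P n (fun i => g \o Z_ i)) => // [i|i j ij].
    exact: (same_law_Rintegral (mZ_ i) mZ (law i) mg2 g2.2).2.
  rewrite (indep2_Rintegral (gZ2 i).1 (gZ2 j).1 _ _ _).2.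
  - by rewrite gZ0 mul0r.
  - exact: indep2_comp (ind i j ij).
  - exact: square_integrable_L1.
  - exact: square_integrable_L1.
apply: (@stoch_bounded_second_moment _ (\int[P]_w (g (Z w) ^+ 2))).
near=> n; have n0 : (0 < n)%N by near: n; exists 1%N.
have nR0 : 0 < n%:R :> R by rewrite ltr0n.
have YE w : Num.sqrt n%:R * (n%:R^-1 * (\sum_(i < n) h (Z_ i w)) - m) =
    (Num.sqrt n%:R)^-1 * \sum_(i < n) g (Z_ i w).
  have s0 : Num.sqrt n%:R != 0 :> R by rewrite gt_eqF// sqrtr_gt0.
  rewrite /g sumrB sumr_const card_ord -(mulr_natl m).
  have := sqr_sqrtr (ltW nR0); move: s0; set s := Num.sqrt _ => s0 <-.
  by field.
have S2 : square_integrable P (fun w => \sum_(i < n) g (Z_ i w)).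
  exact: (square_integrable_sum _ (fun i : 'I_n => gZ2 i)).
split; first by rewrite (funext YE); exact: square_integrableZ.
under eq_Rintegral do rewrite YE exprMn.
rewrite RintegralZl//; last exact: S2.2.
by rewrite gS exprVn (sqr_sqrtr (ltW nR0)) mulKf ?lexx ?(gt_eqF nR0).
Unshelve. all: by end_near. Qed.
End StochasticBoundedness.

(** * Half-vectorization *)

Section HalfVec.
Context {R : realType}.

Lemma sum_hpair (p : nat) (F : 'I_p * 'I_p -> R) :
  \sum_k F (hpair k) =
    \sum_i F (i, i) + \sum_(i : 'I_p) \sum_(j : 'I_p | (i < j)%N) F (i, j).
Proof.
rewrite /hpair -(big_tuple _ _ (Tuple (size_hpairs p)) xpredT F) /= /hpairs big_cat big_map.
rewrite big_allpairs_dep/= big_enum/=; congr (_ + _).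
rewrite big_enum/=; apply: eq_bigr => i _.
by rewrite big_filter big_enum_cond.
Qed.

(** The factor 2 that [vquad] puts on the off-diagonal products accounts for
    the lower triangle, which [vech] drops. *)
Lemma vquad_vech (p : nat) (x : 'cV[R]_p) (M : 'M[R]_p) : M^T = M ->
  \sum_k vquad x k 0 * vech M k 0 = \sum_i \sum_j x i 0 * x j 0 * M i j.
Proof.
move=> symM.
pose F (ij : 'I_p * 'I_p) := (let: (i, j) := ij in
  if i == j then x i 0 ^+ 2 else 2 * x i 0 * x j 0) * M ij.1 ij.2.
rewrite (eq_bigr (fun k => F (hpair k))); last by move=> k _; rewrite /F !mxE.
rewrite sum_hpair {}/F/=.
have -> : \sum_i \sum_j x i 0 * x j 0 * M i j = \sum_i x i 0 * x i 0 * M i i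
    + (\sum_(i : 'I_p) \sum_(j : 'I_p | (i < j)%N) x i 0 * x j 0 * M i j
       + \sum_(i : 'I_p) \sum_(j : 'I_p | (j < i)%N) x i 0 * x j 0 * M i j).
  rewrite -!big_split/=; apply: eq_bigr => i _; rewrite (bigD1 i)//=; congr (_ + _).
  rewrite (bigID (fun j : 'I_p => (i < j)%N))/=; congr (_ + _); apply: eq_bigl => j.
    by rewrite -val_eqE /= neq_ltn orbC; case: ltngtP.
  by rewrite -val_eqE /= neq_ltn; case: ltngtP.
congr (_ + _); first by apply: eq_bigr => i _; rewrite eqxx expr2.
rewrite [X in _ = _ + X](exchange_big_dep predT)//= -big_split/=; apply: eq_bigr => i _.
rewrite -big_split/=; apply: eq_bigr => j ij.
have -> : (i == j) = false by rewrite -val_eqE /=; case: ltngtP ij.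
by rewrite -[in M j i]symM mxE; ring.
Qed.

Lemma uniq_hpairs (p : nat) : uniq (hpairs p).
Proof.
rewrite /hpairs cat_uniq; apply/and3P; split.
- by rewrite map_inj_uniq ?enum_uniq// => i j [].
- apply/hasPn => -[i j] /allpairsPdep[a [b [_ + [-> ->]]]].
  rewrite mem_filter => /andP[ab _]; apply/negP => /mapP[c _ [ac bc]].
  by move: ab; rewrite ac bc ltnn.
apply: allpairs_uniq_dep; rewrite ?enum_uniq//.
  by move=> i _; exact/filter_uniq/enum_uniq.
by move=> [a b] [c e] _ _ /= [-> ->].
Qed.

Lemma hpair_inj (p : nat) : injective (@hpair p).
Proof.
exact/(tuple_uniqP (Tuple (size_hpairs p)))/uniq_hpairs.
Qed.

Lemma hpair_le (p : nat) (k : 'I_(hdim p)) : ((hpair k).1 <= (hpair k).2)%N.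
Proof.
have := mem_tnth k (Tuple (size_hpairs p)); rewrite -/(hpair k) mem_cat.
case: (hpair k) => i j /orP[/mapP[c _ [-> ->]]//|].
move=> /allpairsPdep[a [b [_ + [-> ->]]]].
by rewrite mem_filter => /andP[/ltnW].
Qed.

Lemma hpair_surj (p : nat) (i j : 'I_p) : (i <= j)%N -> exists k, hpair k = (i, j).
Proof.
move=> ij; have : (i, j) \in Tuple (size_hpairs p).
  rewrite mem_cat; case: (eqVneq i j) => [->|nij].
    by rewrite (map_f (fun i => (i, i))) ?mem_enum.
  apply/orP; right; apply/allpairsPdep; exists i, j; split => //.
    by rewrite mem_enum.
  by rewrite mem_filter mem_enum andbT ltn_neqAle ij andbT.
by move=> /tnthP[k ->]; exists k.
Qed.

Lemma vech_surj (p : nat) (b : 'cV[R]_(hdim p)) :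
  exists2 M : 'M[R]_p, M^T = M & vech M = b.
Proof.
pose lo (i j : 'I_p) := if (i <= j)%N then i else j.
pose hi (i j : 'I_p) := if (i <= j)%N then j else i.
have lohi i j : (lo i j <= hi i j)%N by rewrite /lo /hi; case: (leqP i j) => // /ltnW.
pose idx i j := projT1 (cid (hpair_surj (lohi i j))).
have idxE i j : hpair (idx i j) = (lo i j, hi i j) by rewrite /idx; case: cid.
exists (\matrix_(i, j) b (idx i j) 0).
  apply/matrixP => i j; rewrite !mxE; congr (b _ 0); apply: hpair_inj.
  rewrite !idxE /lo /hi; case: (ltngtP i j) => // ij.
  by rewrite (val_inj ij).
apply/matrixP => k c; rewrite !mxE ord1; congr (b _ 0); apply: hpair_inj.
by rewrite idxE /lo /hi hpair_le; case: (hpair k).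
Qed.

End HalfVec.

(** * Quadratic forms and the l1 norm *)

Section QuadraticForms.
Context {R : realType}.

Definition l1norm (p : nat) (u : 'cV[R]_p) : R := \sum_k `|u k 0|.

Lemma l1norm_ge0 p (u : 'cV[R]_p) : 0 <= l1norm u.
Proof. by apply: sumr_ge0 => k _. Qed.

Lemma l1norm_eq0 p (u : 'cV[R]_p) : l1norm u = 0 -> u = 0.
Proof.
move/eqP; rewrite psumr_eq0 => [/allP u0|k _//]; apply/matrixP => k c.
have /= := u0 k (mem_index_enum k); rewrite normr_eq0 => /eqP.
by rewrite ord1 mxE.
Qed.

Lemma dot_le p (u v : 'cV[R]_p) (m : R) : (forall k, `|v k 0| <= m) ->
  `|(u^T *m v) 0 0| <= l1norm u * m.
Proof.
move=> vm; rewrite mxE (le_trans (ler_norm_sum _ _ _))// mulr_suml.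
by apply: ler_sum => k _; rewrite normrM mxE ler_wpM2l.
Qed.

Lemma mulmx_col_le p (E : 'M[R]_p) (u : 'cV[R]_p) (m : R) k :
  (forall k l, `|E k l| <= m) -> `|(E *m u) k 0| <= m * l1norm u.
Proof.
move=> Em; rewrite mxE (le_trans (ler_norm_sum _ _ _))// mulr_sumr.
by apply: ler_sum => l _; rewrite normrM ler_wpM2r.
Qed.

Lemma quad_le p (E : 'M[R]_p) (u : 'cV[R]_p) (m : R) :
  (forall k l, `|E k l| <= m) -> `|(u^T *m E *m u) 0 0| <= m * l1norm u ^+ 2.
Proof.
move=> Em; rewrite -mulmxA (le_trans (dot_le _ (fun k => mulmx_col_le u k Em)))//.
by rewrite mulrCA expr2.
Qed.

Lemma quadD p (G : 'M[R]_p) (u v : 'cV[R]_p) : G^T = G ->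
  ((u + v)^T *m G *m (u + v)) 0 0 = (u^T *m G *m u) 0 0
    + 2 * (v^T *m G *m u) 0 0 + (v^T *m G *m v) 0 0.
Proof.
move=> symG.
have uGv : (u^T *m G *m v) 0 0 = (v^T *m G *m u) 0 0.
  have -> : v^T *m G *m u = (u^T *m G *m v)^T.
    by rewrite !trmx_mul trmxK symG mulmxA.
  by rewrite [in RHS]mxE.
rewrite [(_ + _)^T]linearD/= !mulmxDl !mulmxDr.
have addE (A B : 'M[R]_1) : (A + B) 0 0 = A 0 0 + B 0 0 by rewrite mxE.
rewrite !addE uGv; ring.
Qed.

Lemma quadZ p (G : 'M[R]_p) (a : R) (u : 'cV[R]_p) :
  ((a *: u)^T *m G *m (a *: u)) 0 0 = a ^+ 2 * (u^T *m G *m u) 0 0.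
Proof.
rewrite [(a *: u)^T]linearZ/= -!scalemxAl -scalemxAr scalerA.
by rewrite mxE expr2.
Qed.

(** The form is non-negative at u - t v for the t that minimizes it. *)
Lemma pdmx_cauchy_schwarz p (C : 'M[R]_p) (u v : 'cV[R]_p) : pdmx C ->
  (v^T *m C *m u) 0 0 ^+ 2 <= (v^T *m C *m v) 0 0 * (u^T *m C *m u) 0 0.
Proof.
move=> [symC posC]; have [->|v0] := eqVneq v 0.
  by rewrite trmx0 !mul0mx mxE expr2 !mul0r.
have qv := posC _ v0; set t := (v^T *m C *m u) 0 0.
have q0 (w : 'cV_p) : 0 <= (w^T *m C *m w) 0 0.
  have [->|/posC/ltW//] := eqVneq w 0.
  by rewrite trmx0 !mul0mx mxE.
set qv' := (v^T *m C *m v) 0 0 in qv *.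
have := q0 (u + (- (t / qv')) *: v).
rewrite quadD// quadZ [(_ *: v)^T]linearZ/= -!scalemxAl.
have scaleE a (A : 'M[R]_1) : (a *: A) 0 0 = a * A 0 0 by rewrite mxE.
rewrite scaleE -/t -/qv'.
set qu := (u^T *m C *m u) 0 0.
have -> : qu + 2 * (- (t / qv') * t) + (- (t / qv')) ^+ 2 * qv' = qu - t ^+ 2 / qv'.
  by field; rewrite gt_eqF.
by rewrite subr_ge0 ler_pdivrMr// mulrC.
Qed.

Lemma pdmx_unit p (C : 'M[R]_p) : pdmx C -> C \in unitmx.
Proof.
move=> [symC posC]; rewrite -row_free_unit -kermx_eq0; apply/rowV0P => v /sub_kermxP vC.
apply/eqP; rewrite -[v]trmxK trmx_eq0; apply: contraT => /posC.
by rewrite trmxK vC mul0mx mxE ltxx.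
Qed.

(** Each coordinate of u is the inner product, for C, of u with a fixed vector,
    so Cauchy-Schwarz bounds every coordinate, and hence the l1 norm, by the
    square root of the quadratic form. *)
Lemma pdmx_coercive p (C : 'M[R]_p) : pdmx C ->
  exists2 c : R, 0 < c &
    forall u, c * l1norm u ^+ 2 <= (u^T *m C *m u) 0 0.
Proof.
move=> pdC; have uC := pdmx_unit pdC.
(* The vector a k represents the k-th coordinate: u k = <a k, u> for C. *)
pose a k : 'cV_p := invmx C *m delta_mx k 0.
pose K := \sum_k Num.sqrt (((a k)^T *m C *m a k) 0 0).
have q0 (w : 'cV_p) : 0 <= (w^T *m C *m w) 0 0.
  have [->|/pdC.2/ltW//] := eqVneq w 0.
  by rewrite trmx0 !mul0mx mxE.
have K1 : 0 < 1 + K ^+ 2 by rewrite ltr_pwDl// sqr_ge0.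
exists (1 + K ^+ 2)^-1; rewrite ?invr_gt0// => u.
rewrite mulrC ler_pdivrMr//.
have uK : l1norm u <= K * Num.sqrt ((u^T *m C *m u) 0 0).
  rewrite /K mulr_suml; apply: ler_sum => k _.
  have -> : u k 0 = ((a k)^T *m C *m u) 0 0.
    rewrite /a trmx_mul trmx_inv pdC.1 mulmxKV// trmx_delta.
    by rewrite -rowE mxE.
  rewrite -sqrtr_sqr -sqrtrM//; apply: ler_wsqrtr.
  exact: pdmx_cauchy_schwarz.
have K0 : 0 <= K by apply: sumr_ge0 => k _; exact: sqrtr_ge0.
have := q0 u; set q := (_ *m u) 0 0 in uK * => q0u.
have : l1norm u ^+ 2 <= (K * Num.sqrt q) ^+ 2.
  by rewrite ler_sqr ?nnegrE ?l1norm_ge0// mulr_ge0// sqrtr_ge0.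
rewrite exprMn sqr_sqrtr//; nra.
Qed.

End QuadraticForms.

(** * Minimizers of a penalized quadratic function *)

Section PenalizedQuadratic.
Context {R : realType}.
Variables (D : nat) (G : 'M[R]_D) (z sigma init : 'cV[R]_D) (lam q0 c : R).
Hypotheses (symG : G^T = G) (lam0 : 0 < lam) (c0 : 0 < c).
Hypothesis coercG : forall u, c * l1norm u ^+ 2 <= (u^T *m G *m u) 0 0.

Definition adaptive_penalty (b : 'cV[R]_D) : R := \sum_k `|b k 0| / `|init k 0|.

(** The adaptive LASSO objective expanded around the target [sigma]: [G] is the
    sample Gram matrix, [z] the score at [sigma], [q0] the residual sum of
    squares at [sigma] divided by the sample size. *)
Definition penalized_quad (b : 'cV[R]_D) : R :=
  q0 - 2 * ((b - sigma)^T *m z) 0 0 + ((b - sigma)^T *m G *m (b - sigma)) 0 0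
  + 2 * lam * adaptive_penalty b.

Let dom : set 'cV[R]_D := [set b | forall k, init k 0 = 0 -> b k 0 = 0].
Let Q := penalized_quad.

Lemma dotDl (u v w : 'cV[R]_D) :
  ((u + v)^T *m w) 0 0 = (u^T *m w) 0 0 + (v^T *m w) 0 0.
Proof. by rewrite [(u + v)^T]linearD/= mulmxDl mxE. Qed.

Lemma dotZl a (u w : 'cV[R]_D) : ((a *: u)^T *m w) 0 0 = a * (u^T *m w) 0 0.
Proof. by rewrite [(a *: u)^T]linearZ/= -scalemxAl mxE. Qed.

(** The penalty is convex and the quadratic part strictly convex, so the
    midpoint of two distinct minimizers would do better than both. *)
Lemma penalized_quad_unique (b1 b2 : 'cV[R]_D) :
  argmin dom Q b1 -> dom b2 -> Q b2 <= Q b1 -> b2 = b1.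
Proof.
move=> [d1 min1] d2 Q21.
pose m := 2^-1 *: (b1 + b2).
have dm : dom m by move=> k k0; rewrite !mxE d1// d2// addr0 mulr0.
have penm : 2 * adaptive_penalty m <= adaptive_penalty b1 + adaptive_penalty b2.
  rewrite /adaptive_penalty mulr_sumr -big_split/=; apply: ler_sum => k _.
  rewrite -mulrDl mulrA ler_wpM2r ?invr_ge0// !mxE normrM ger0_norm ?invr_ge0//.
  by rewrite mulrA mulfV ?mul1r ?pnatr_eq0// ler_normD.
pose v := 2^-1 *: (b1 - b2); pose u := m - sigma.
have e1 : b1 - sigma = u + v.
  by apply/matrixP => k j; rewrite !mxE; field.
have e2 : b2 - sigma = u + (- 1) *: v.
  by apply/matrixP => k j; rewrite !mxE; field.
have := quadD u v symG; have := quadD u ((- 1) *: v) symG.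
rewrite quadZ -(mulmxA (- 1 *: v)^T) dotZl mulmxA => q2 q1.
have := dotDl u (- 1 *: v) z; rewrite [in X in _ = X -> _]dotZl => l2.
have := min1 _ dm; move: Q21; rewrite /Q /penalized_quad -/u e1 e2 q1 q2 l2 (dotDl u v).
have := ler_wpM2l (ltW lam0) penm.
set p1 := adaptive_penalty b1; set p2 := adaptive_penalty b2.
set pm := adaptive_penalty m => lp Q21 Q1m.
have v0 : l1norm v = 0.
  apply/eqP; rewrite -sqrf_eq0 eq_le sqr_ge0 andbT -(pmulr_rle0 _ c0).
  apply: le_trans (coercG v) _; lra.
have /matrixP v00 := l1norm_eq0 v0.
apply/matrixP => k j; have := v00 k j; rewrite !mxE => /eqP.
by rewrite mulf_eq0 invr_eq0 pnatr_eq0/= subr_eq0 => /eqP.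
Qed.

(** The minimizer does at least as well as [sigma].  There the penalty of an
    inactive coordinate is zero, so only active coordinates, whose weights
    are bounded by [tau], contribute to the loss in penalty. *)
Lemma penalized_quad_rate (b : 'cV[R]_D) (zeta tau : R) :
  argmin dom Q b -> dom sigma ->
  (forall k, `|z k 0| <= zeta) ->
  (forall k, sigma k 0 != 0 -> `|init k 0|^-1 <= tau) -> 0 <= zeta -> 0 <= tau ->
  l1norm (b - sigma) <= 2 * (zeta + lam * tau) / c.
Proof.
move=> [db minb] ds zzeta itau zeta0 tau0.
have := minb _ ds; rewrite /Q /penalized_quad subrr.
have z00 : (0 : 'M[R]_1) 0 0 = 0 by rewrite mxE.
set u := b - sigma; rewrite trmx0 !mul0mx z00 => Qb.
have pen : adaptive_penalty sigma - adaptive_penalty b <= tau * l1norm u.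
  rewrite /adaptive_penalty -sumrB mulr_sumr; apply: ler_sum => k _.
  rewrite -mulrBl; have [s0|s0] := eqVneq (sigma k 0) 0.
    rewrite s0 normr0 sub0r mulNr (@le_trans _ _ 0)//; last exact: mulr_ge0.
  rewrite mulrC; apply: (@le_trans _ _ (`|init k 0|^-1 * `|u k 0|)).
    rewrite ler_wpM2l ?invr_ge0//.
    by rewrite !mxE -[`|b k 0 - _|]normrN opprB lerB_dist.
  by rewrite ler_wpM2r// itau.
have uz := le_trans (ler_norm _) (dot_le u zzeta).
have cu := coercG u; have l0 := l1norm_ge0 u; rewrite ler_pdivlMr//.
have [l00|lpos] := eqVneq (l1norm u) 0.
  by rewrite l00 mul0r mulr_ge0// addr_ge0// mulr_ge0// ltW.
have {}lpos : 0 < l1norm u by rewrite lt_neqAle eq_sym lpos.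
rewrite -(ler_pM2l lpos).
have lp := ler_wpM2l (ltW lam0) pen; lra.
Qed.

(** If the coordinate were t != 0, setting it to zero would save the penalty
    2 lam |t| / |init k| and raise the rest by at most 2 |t| (zeta + g L).
    This bound expands the quadratic part around the modified vector, where
    the term in t ^ 2 has the favourable sign. *)
Lemma penalized_quad_select (b : 'cV[R]_D) (zeta g L iota : R) (k : 'I_D) :
  argmin dom Q b -> sigma k 0 = 0 ->
  (forall k, `|z k 0| <= zeta) -> (forall k l, `|G k l| <= g) ->
  l1norm (b - sigma) <= L -> `|init k 0| <= iota ->
  (zeta + g * L) * iota < lam -> b k 0 = 0.
Proof.
move=> [db minb] sk zzeta Gg uL ik small; apply/eqP/negPn/negP => bk.
have ik0 : init k 0 != 0 by apply: contra bk => /eqP/db ->.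
pose t := b k 0; pose e : 'cV[R]_D := delta_mx k 0; pose b' := b + (- t) *: e.
have b'E l : b' l 0 = if l == k then 0 else b l 0.
  rewrite !mxE eqxx andbT; case: eqP => [->|_]; first by rewrite mulr1 subrr.
  by rewrite mulr0 addr0.
have db' : dom b' by move=> l l0; rewrite b'E; case: ifP => // _; exact: db.
pose u' := b' - sigma.
have uE : b - sigma = u' + t *: e.
  by apply/matrixP => l j; rewrite /u' /b' !mxE; ring.
have u'L : l1norm u' <= L.
  apply: le_trans uL; apply: ler_sum => l _.
  rewrite !mxE -/(b' l 0); have := b'E l; rewrite !mxE => ->.
  by case: eqP => // ->; rewrite sk subrr normr0.
have pen : adaptive_penalty b = adaptive_penalty b' + `|t| / `|init k 0|.
  rewrite /adaptive_penalty (bigD1 k)//= [in RHS](bigD1 k)//= b'E eqxx normr0 mul0r.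
  rewrite add0r addrC; congr (_ + _); apply: eq_bigr => l lk.
  by rewrite b'E (negbTE lk).
have ez (w : 'cV[R]_D) : (e^T *m w) 0 0 = w k 0.
  by rewrite /e trmx_delta -rowE mxE.
have := minb _ db'; rewrite /Q /penalized_quad uE -/u' quadD// quadZ dotDl dotZl pen.
rewrite ez -2!mulmxA dotZl !ez => Qbb'.
have Gu' := mulmx_col_le u' k Gg; have zk := zzeta k.
have Gkk : 0 <= (e^T *m G *m e) 0 0.
  apply: le_trans (coercG e).
  by rewrite mulr_ge0 ?sqr_ge0 ?(ltW c0).
have g0 : 0 <= g by exact: le_trans (Gg k k).
have t0 : 0 < `|t| by rewrite normr_gt0.
have ik1 : 0 < `|init k 0| by rewrite normr_gt0.
have key : `|t| * (lam / `|init k 0|) <= `|t| * (zeta + g * L).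
  have t1 : t * z k 0 <= `|t| * zeta.
    by rewrite (le_trans (ler_norm _))// normrM ler_wpM2l.
  have t2 : - (t * (G *m u') k 0) <= `|t| * (g * L).
    rewrite (le_trans (ler_norm _))// normrN normrM ler_wpM2l//.
    by rewrite (le_trans Gu')// ler_wpM2l.
  have t3 : 0 <= t ^+ 2 * (e^T *m G *m e) 0 0 by rewrite mulr_ge0// sqr_ge0.
  move: Qbb'; set pb := adaptive_penalty b'; set a := `|t| / _ => Qbb'.
  have -> : `|t| * (lam / `|init k 0|) = lam * a by rewrite /a; ring.
  lra.
have : lam <= (zeta + g * L) * iota.
  move: key; rewrite ler_pM2l// ler_pdivrMr// => /le_trans; apply.
  rewrite ler_wpM2l// addr_ge0//; first exact: le_trans zk.
  by rewrite mulr_ge0// (le_trans (l1norm_ge0 u')).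
by rewrite leNgt small.
Qed.

End PenalizedQuadratic.

(** * Perturbing a positive definite block *)

Section BlockPsd.
Context {R : realType}.

(** The index does not depend on the matrix, so two symmetric matrices can be
    compared entrywise through their half-vectorizations. *)
Lemma vech_entry (p : nat) (i j : 'I_p) : exists k, forall M : 'M[R]_p,
  M^T = M -> M i j = vech M k 0.
Proof.
have [ij|ji] := leqP i j.
  by have [k kE] := hpair_surj ij; exists k => M symM; rewrite mxE kE.
have [k kE] := hpair_surj (ltnW ji); exists k => M symM.
by rewrite mxE kE -[in LHS]symM mxE.
Qed.

(** A perturbation of size c of the block, in the maximum norm, changes the
    quadratic form by at most c |v|^2 for the l1 norm, which coercivity of the
    block absorbs; off the block nothing changes.  The condition on the zero
    pattern is what exact selection provides. *)
Lemma block_psd_nbhs (p d e : nat) (hde : (d + e)%N = p) (S1 : 'M[R]_d)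
    (S : 'M[R]_p) : pdmx S1 -> S = castmx (hde, hde) (block_mx S1 0 0 0) ->
  exists2 c : R, 0 < c & forall M : 'M[R]_p, M^T = M ->
    (forall i j, S i j = 0 -> M i j = 0) ->
    (forall i j, `|M i j - S i j| <= c) -> psdmx M.
Proof.
move=> pd1; case: p / hde S => S; rewrite castmx_id => SE.
have [c c0 cS1] := pdmx_coercive pd1; exists c => // M symM M0 MS.
have ME : M = block_mx (ulsubmx M) 0 0 0.
  rewrite -[LHS]submxK; congr block_mx; apply/matrixP => i j; rewrite !mxE M0// SE.
  - by rewrite block_mxEur mxE.
  - by rewrite block_mxEdl mxE.
  - by rewrite block_mxEdr mxE.
split => // u; rewrite -[u]vsubmxK; set v := usubmx u.
rewrite tr_col_mx ME mul_row_block !mulmx0 !addr0 mul_row_col mul0mx addr0.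
rewrite -[ulsubmx M](subrK S1) mulmxDr mulmxDl mxE.
have := quad_le (m := c) (E := ulsubmx M - S1) v.
have H k l : `|(ulsubmx M - S1) k l| <= c.
  by have := MS (lshift e k) (lshift e l); rewrite SE block_mxEul !mxE.
move=> /(_ H); rewrite ler_norml => /andP[+ _]; have := cS1 v; lra.
Qed.

End BlockPsd.

(** * The adaptive LASSO objective around the target *)

Section LassoObjective.
Context {R : realType} {q : nat}.

Definition sample_gram n (s : n.-tuple (obs R q)) : 'M[R]_(hdim q.+1) :=
  n%:R^-1 *: ((Xsigma s)^T *m Xsigma s).

(** Minus half the gradient, at [sigma], of the least squares part of the
    objective. *)
Definition sample_score n (s : n.-tuple (obs R q)) (mu : 'cV[R]_q.+1)
    (sigma : 'cV[R]_(hdim q.+1)) : 'cV[R]_(hdim q.+1) :=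
  n%:R^-1 *: ((Xsigma s)^T *m (Ysigma s mu - Xsigma s *m sigma)).

Lemma norm2_sqr k (v : 'cV[R]_k) : norm2 v ^+ 2 = (v^T *m v) 0 0.
Proof.
rewrite sqr_sqrtr; last by apply: sumr_ge0 => i _; exact: sqr_ge0.
by rewrite mxE; apply: eq_bigr => i _; rewrite mxE expr2.
Qed.

Lemma sample_gram_sym n (s : n.-tuple (obs R q)) : (sample_gram s)^T = sample_gram s.
Proof. by rewrite /sample_gram linearZ/= trmx_mul trmxK. Qed.

Lemma lasso_objectiveE n (s : n.-tuple (obs R q)) mu init lam
    (sigma b : 'cV[R]_(hdim q.+1)) :
  lasso_objective s mu init lam b =
  penalized_quad (sample_gram s) (sample_score s mu sigma) sigma init lam
    (n%:R^-1 * norm2 (Ysigma s mu - Xsigma s *m sigma) ^+ 2) b.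
Proof.
rewrite /lasso_objective /penalized_quad /adaptive_penalty; congr (_ + _).
set X := Xsigma s; set Y := Ysigma s mu; set u := b - sigma.
set r := Y - X *m sigma.
have -> : Y - X *m b = r + (- 1) *: (X *m u).
  rewrite /r /u mulmxBr scaleN1r.
  by rewrite opprB addrA subrK.
rewrite !norm2_sqr.
have quad1 (a c : 'cV[R]_n) : ((a + c)^T *m (a + c)) 0 0 =
   (a^T *m a) 0 0 + 2 * (c^T *m a) 0 0 + (c^T *m c) 0 0.
  by have := quadD a c (trmx1 R n); rewrite !mulmx1.
rewrite quad1 [(-1 *: _)^T]linearZ/= -!scalemxAl -scalemxAr scalerA.
have scaleE a (A : 'M[R]_1) : (a *: A) 0 0 = a * A 0 0 by rewrite mxE.
rewrite !scaleE trmx_mul /sample_score /sample_gram -/X -/Y -/r.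
rewrite -!scalemxAr -scalemxAl !scaleE !mulmxA; ring.
Qed.

Lemma sample_gramE n (s : n.-tuple (obs R q)) k l : sample_gram s k l =
  n%:R^-1 * \sum_(i < n) vquad (covariates (tnth s i).2) k 0
                         * vquad (covariates (tnth s i).2) l 0.
Proof.
by rewrite !mxE; congr (_ * _); apply: eq_bigr => i _; rewrite !mxE.
Qed.

Lemma sample_scoreE n (s : n.-tuple (obs R q)) mu sigma k :
  sample_score s mu sigma k 0 =
  n%:R^-1 * \sum_(i < n) vquad (covariates (tnth s i).2) k 0 *
    (((tnth s i).1 - ((covariates (tnth s i).2)^T *m mu) 0 0) ^+ 2
     - \sum_l vquad (covariates (tnth s i).2) l 0 * sigma l 0).
Proof.
rewrite mxE; congr (_ * _); rewrite mxE; apply: eq_bigr => i _.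
rewrite !mxE; congr (_ * (_ - _)).
by apply: eq_bigr => l _; rewrite mxE.
Qed.

(** The unconstrained minimizer lands in the constraint set, hence it also
    solves the constrained problem, and strict convexity leaves no other. *)
Lemma adaptive_lasso_psd_eq n (s : n.-tuple (obs R q)) (mu : 'cV[R]_q.+1)
    (init b bpos : 'cV[R]_(hdim q.+1)) (lam : R) (S : 'M[R]_q.+1) (c g zeta tau iota L : R) :
  S^T = S -> 0 < lam -> 0 < c -> 0 <= tau -> 0 <= zeta ->
  (forall u, c * l1norm u ^+ 2 <= (u^T *m sample_gram s *m u) 0 0) ->
  (forall k l, `|sample_gram s k l| <= g) ->
  (forall k, `|sample_score s mu (vech S) k 0| <= zeta) ->
  (forall k, vech S k 0 != 0 -> 1 <= tau * `|init k 0|) ->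
  (forall k, vech S k 0 = 0 -> `|init k 0| <= iota) ->
  2 * (zeta + lam * tau) / c <= L -> (zeta + g * L) * iota < lam ->
  (forall M : 'M[R]_q.+1, M^T = M -> (forall i j, S i j = 0 -> M i j = 0) ->
    (forall i j, `|M i j - S i j| <= L) -> psdmx M) ->
  adaptive_lasso s mu init lam b -> adaptive_lasso_psd s mu init lam bpos ->
  bpos = b.
Proof.
move=> symS lam0 c0 tau0 zeta0 coercG Gg zzeta itau iiota ratio small nbhsS.
have QE := funext (lasso_objectiveE s mu init lam (vech S)).
rewrite /adaptive_lasso /adaptive_lasso_psd QE => bmin [[_ dpos] minpos].
have init0 k : vech S k 0 != 0 -> 0 < `|init k 0|.
  move=> /itau; rewrite normr_gt0; apply: contraTneq => ->.
  by rewrite normr0 mulr0 ler10.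
have dS : lasso_domain init (vech S).
  move=> k k0; apply/eqP; apply: contraT => /init0.
  by rewrite k0 normr0 ltxx.
have itau' k : vech S k 0 != 0 -> `|init k 0|^-1 <= tau.
  by move=> Sk; rewrite -[leLHS]mul1r ler_pdivrMr ?init0// itau.
have symG := sample_gram_sym s.
have rate : l1norm (b - vech S) <= L.
  apply: le_trans ratio.
  exact: (penalized_quad_rate lam0 c0 coercG bmin dS zzeta itau').
have select k : vech S k 0 = 0 -> b k 0 = 0.
  move=> Sk.
  exact: (penalized_quad_select symG c0 coercG bmin Sk zzeta Gg rate (iiota k Sk)).
have [M symM Mb] := vech_surj b.
have bS k : `|b k 0 - vech S k 0| <= L.
  apply: le_trans rate; rewrite /l1norm (bigD1 k)//= !mxE lerDl.
  by apply: sumr_ge0.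
have psdM : psdmx M.
  apply: nbhsS => // i j; have [k kE] := @vech_entry R _ i j; rewrite !kE// Mb.
    exact: select.
  exact: bS.
apply: (penalized_quad_unique symG lam0 c0 coercG bmin dpos).
by apply: minpos; split; [exists M|exact: bmin.1].
Qed.

End LassoObjective.

(** * Deterministic rates *)

Section Rates.
Context {R : realType}.

Lemma sqrtn_ge (A : R) : \forall n \near \oo, A <= Num.sqrt n%:R.
Proof.
near=> n; rewrite (le_trans (ler_norm A))// -sqrtr_sqr ler_wsqrtr//.
by near: n; exact: nbhs_infty_ger.
Unshelve. all: by end_near. Qed.

(** Here eps = M / sqrt n bounds the random errors and L is the resulting bound
    on the distance from the estimate to the target.  Both are O(1 / sqrt n),
    as sqrt n * lam n -> 0, and the last inequality, of the order
    1 / n < lam n, is where n * lam n -> oo enters. *)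
Lemma eventually_rates (lam : nat -> R) (c0 g0 kappa tau0 M : R) :
  0 < c0 -> 0 <= g0 -> 0 < kappa -> 0 < tau0 -> 0 <= M ->
  Num.sqrt n%:R * lam n @[n --> \oo] --> 0 ->
  n%:R * lam n @[n --> \oo] --> +oo ->
  \forall n \near \oo, let eps := M / Num.sqrt n%:R in
    let L := 2 * (eps + lam n * (2 * tau0)) / (c0 / 2) in
    [/\ (0 < n)%N, eps <= c0 / 2, eps * (2 * tau0) <= 1, eps <= M & L <= kappa]
    /\ (eps + (g0 + M) * L) * eps < lam n.
Proof.
move=> c00 g00 kappa0 tau00 M0 sqrt_lam n_lam.
set K := 4 * (M + 1) / c0.
have K0 : 0 <= K by rewrite /K divr_ge0 ?(ltW c00)// mulr_ge0// addr_ge0.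
have t0 : 0 < (2 * tau0)^-1 by rewrite invr_gt0 mulr_gt0.
near=> n; move=> /=; set eps := M / _; set L := 2 * _ / _.
have n0 : (0 < n)%N by near: n; exists 1%N.
have nR0 : 0 < n%:R :> R by rewrite ltr0n.
have r0 : 0 < Num.sqrt n%:R :> R by rewrite sqrtr_gt0.
have r1 : 1 <= Num.sqrt n%:R :> R by near: n; exact: sqrtn_ge.
have r2 : M / (c0 / 2) <= Num.sqrt n%:R by near: n; exact: sqrtn_ge.
have r3 : M * (2 * tau0) <= Num.sqrt n%:R by near: n; exact: sqrtn_ge.
have r4 : K / kappa <= Num.sqrt n%:R by near: n; exact: sqrtn_ge.
have rl : `|Num.sqrt n%:R * lam n| <= (2 * tau0)^-1.
  by near: n; apply: cvgr0_norm_le.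
have nl : (M + (g0 + M) * K) * M + 1 <= n%:R * lam n.
  by near: n; move: n_lam => /cvgryPge; apply.
have rn : Num.sqrt n%:R ^+ 2 = n%:R :> R by rewrite sqr_sqrtr// ltW.
set r := Num.sqrt n%:R in eps L r0 r1 r2 r3 r4 rl rn *.
(* K is the value of sqrt n * L when sqrt n * lam n * (2 tau0) reaches 1. *)
have LK : L <= K / r.
  have x1 : r * lam n * (2 * tau0) <= 1.
    rewrite -ler_pdivlMr ?mulr_gt0// mul1r.
    exact: le_trans (ler_norm _) rl.
  rewrite ler_pdivlMr// /L /K.
  have -> : 2 * (eps + lam n * (2 * tau0)) / (c0 / 2) * r =
      4 * (M + r * lam n * (2 * tau0)) / c0.
    by rewrite /eps; field; rewrite !gt_eqF.
  by rewrite ler_pM2r ?invr_gt0// ler_pM2l// lerD2l.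
have epsr : eps * r = M by rewrite /eps divfK ?gt_eqF.
split; first split => //.
- by rewrite /eps ler_pdivrMr// mulrC -ler_pdivrMr ?divr_gt0.
- by rewrite /eps mulrAC ler_pdivrMr// mul1r.
- by rewrite /eps ler_pdivrMr// ler_peMr.
- by rewrite (le_trans LK)// ler_pdivrMr// mulrC -ler_pdivrMr.
have eps0 : 0 <= eps by rewrite /eps divr_ge0// ltW.
have gM : 0 <= g0 + M by exact: addr_ge0.
apply: (@le_lt_trans _ _ ((M + (g0 + M) * K) / r * eps)).
  by rewrite ler_wpM2r// [leRHS]mulrDl lerD// -[leRHS]mulrA ler_wpM2l.
rewrite /eps mulf_div -expr2 rn ltr_pdivrMr// mulrC [lam n * _]mulrC; lra.
Unshelve. all: by end_near. Qed.
End Rates.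

(** * Moments and the squared residual *)

Section Moments.
Context {d : measure_display} {T : measurableType d} {R : realType}.
Variable P : probability T R.

Lemma stoch_bounded_sqrtn (f : nat -> T -> R) :
  stoch_bounded P (fun n w => Num.sqrt n%:R * f n w) -> stoch_bounded P f.
Proof.
move=> bf; apply: (stoch_bounded_le bf); near=> n => w.
rewrite normrM ler_peMl// ger0_norm ?sqrtr_ge0//.
by near: n; exact: sqrtn_ge.
Unshelve. all: by end_near. Qed.

Lemma finite_moment_integrable (r p : nat) (Z : T -> p.-tuple R) (k : 'I_p) :
  measurable_fun setT Z -> finite_moment P r.*2 Z ->
  P.-integrable setT (EFin \o (fun w => tnth (Z w) k ^+ r.*2)).
Proof.
move=> mZ Zr; have mk : measurable_fun setT (fun w => tnth (Z w) k).
  exact: (measurableT_comp (measurable_tnth k) mZ).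
apply/integrableP; split.
  by apply/measurable_EFinP; exact: measurable_funX.
have := Zr k; rewrite unlock; apply: le_lt_trans.
by apply: ge0_le_integral => //; [
  by do 2 apply: measurableT_comp => //; exact: measurable_funX
 |by apply/measurable_EFinP; apply: measurable_funX; exact: measurableT_comp
 |by move=> w _ /=; rewrite lee_fin normrX].
Qed.

Lemma square_integrable_mul4 (f g : T -> R) :
  measurable_fun setT f -> measurable_fun setT g ->
  P.-integrable setT (EFin \o (fun w => f w ^+ 4)) ->
  P.-integrable setT (EFin \o (fun w => g w ^+ 4)) ->
  square_integrable P (f \* g).
Proof.
move=> mf mg f4 g4; split; first exact: measurable_funM.
apply: (integrable_le _ _ (integrableD measurableT f4 g4)).
  by apply: measurable_funX; exact: measurable_funM.
move=> w /=; rewrite ger0_norm ?sqr_ge0// exprMn.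
have -> : f w ^+ 4 = (f w ^+ 2) ^+ 2 by rewrite -exprM.
have -> : g w ^+ 4 = (g w ^+ 2) ^+ 2 by rewrite -exprM.
have := sqr_ge0 (f w); have := sqr_ge0 (g w).
move: (f w ^+ 2) (g w ^+ 2) => x y x0 y0; nra.
Qed.

Lemma integrable4_square (f : T -> R) : measurable_fun setT f ->
  P.-integrable setT (EFin \o (fun w => f w ^+ 4)) -> square_integrable P f.
Proof.
move=> mf f4; have -> : f = f \* cst 1 by apply/funext => w /=; rewrite mulr1.
apply: square_integrable_mul4 => //.
exact: (finite_measure_integrable_cst P (1 ^+ 4) measurableT).
Qed.

(** Two applications of x^2 y^2 <= x^4 + y^4: the square of a product of four
    factors is at most the sum of their eighth powers. *)
Lemma square_integrable_mul8 (I : Type) (f : I -> T -> R) :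
  (forall i, measurable_fun setT (f i)) ->
  (forall i, P.-integrable setT (EFin \o (fun w => f i w ^+ 8))) ->
  forall a b c e,
    square_integrable P (fun w => (f a w * f b w) * (f c w * f e w)).
Proof.
move=> mf f8 a b c e.
have m2 i j : measurable_fun setT (f i \* f j) by exact: measurable_funM.
have i4 i j : P.-integrable setT (EFin \o (fun w => (f i w * f j w) ^+ 4)).
  apply: (integrable_le _ _ (integrableD measurableT (f8 i) (f8 j))).
    by apply: measurable_funX; exact: m2.
  move=> w /=; move: (f i w) (f j w) => x y.
  have -> : x ^+ 8 = (x ^+ 4) ^+ 2 by rewrite -exprM.
  have -> : y ^+ 8 = (y ^+ 4) ^+ 2 by rewrite -exprM.
  rewrite exprMn ger0_norm; last by rewrite -exprMn -[4%N]/(2 * 2)%N exprM sqr_ge0.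
  have := sqr_ge0 (x ^+ 4 - y ^+ 4); have := sqr_ge0 (x ^+ 4 + y ^+ 4); nra.
exact: (square_integrable_mul4 (m2 a b) (m2 c e) (i4 a b) (i4 c e)).
Qed.

End Moments.

Lemma vquadE {R : realType} (p : nat) (x : 'cV[R]_p) k :
  vquad x k 0 = (if (hpair k).1 == (hpair k).2 then 1 else 2)
    * (x (hpair k).1 0 * x (hpair k).2 0).
Proof.
rewrite mxE; case: (hpair k) => i j /=; case: eqP => [->|_]; first by rewrite mul1r expr2.
by rewrite mulrA.
Qed.

(** With dl the error of the mean estimator and b = a - E a, the squared
    residual centred by x^T S x splits into a noise term, two cross terms
    linear in dl and a term quadratic in dl. *)
Lemma residual_expansion {R : realType} (p : nat) (x b dl : 'I_p -> R) (S : 'I_p -> 'I_p -> R) :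
  (\sum_j x j * (b j - dl j)) ^+ 2 - \sum_j \sum_l x j * x l * S j l =
  \sum_j \sum_l (x j * x l * (b j * b l - S j l) - dl l * (x j * x l * b j)
     - dl j * (x j * x l * b l) + dl j * dl l * (x j * x l)).
Proof.
rewrite expr2 mulr_suml -sumrB; apply: eq_bigr => j _.
rewrite mulr_sumr -sumrB; apply: eq_bigr => l _; ring.
Qed.

(** * Root-n rates for the sample Gram matrix and the score *)

Section ModelRates.
Context {R : realType} {disp : measure_display} {T : measurableType disp}.
Context (P : probability T R) (q : nat).
Context (W : {RV P >-> q.-tuple R}) (A : {RV P >-> q.+1.-tuple R}).
Context (W_ : nat -> {RV P >-> q.-tuple R}) (A_ : nat -> {RV P >-> q.+1.-tuple R}).

Let Z w := (with_intercept (W w), A w).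
Let Z_ i w := (with_intercept (W_ i w), A_ i w).

Hypothesis hindep : indep_seq P Z_.
Hypothesis hlaw : forall i, same_law P (Z_ i) Z.
Hypothesis hXA : indep2 P (fun w => with_intercept (W w)) A.
Hypothesis hA4 : finite_moment P 4 A.
Hypothesis hX8 : finite_moment P 8 (fun w => with_intercept (W w)).

Let mu := mean_vec P A.
Let Sig := cov_mx P A.

Lemma measurable_with_intercept (V : {RV P >-> q.-tuple R}) :
  measurable_fun setT (fun w => with_intercept (V w)).
Proof.
apply/measurable_fun_tnthP => i; case: (unliftP ord0 i) => [j ->|->].
  rewrite (_ : _ \o _ = (fun w => tnth (V w) j)).
    exact: (measurableT_comp (measurable_tnth j)).
  by apply/funext => w /=; rewrite /with_intercept tnthS.
by rewrite (_ : _ \o _ = cst 1)//; apply/funext => w /=; rewrite tnth0.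
Qed.

Let mZ : measurable_fun setT Z.
Proof. by apply: measurable_fun_pair => //; exact: measurable_with_intercept. Qed.

Let mZ_ i : measurable_fun setT (Z_ i).
Proof. by apply: measurable_fun_pair => //; exact: measurable_with_intercept. Qed.

Lemma indep_seq_pair i j : i != j -> indep2 P (Z_ i) (Z_ j).
Proof.
move=> ij B C mB mC; pose D k := if k == i then B else C.
have := hindep (J := [:: i; j]) (B := D).
rewrite /= inE ij => /(_ isT) H.
have {}H : P (\bigcap_(k in [set` [:: i; j]]) (Z_ k @^-1` D k)) =
    (\prod_(k <- [:: i; j]) P (Z_ k @^-1` D k))%E.
  by apply: H => k; rewrite /D; case: ifP.
move: H; rewrite !big_cons big_nil mule1 /D eqxx eq_sym (negbTE ij) => <-.
congr (P _); apply/seteqP; split => [w [Bw Cw] k|w H].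
  by rewrite /= !inE => /orP[] /eqP ->; rewrite ?eqxx// eq_sym (negbTE ij).
split; first by have := H i; rewrite /= !inE eqxx => /(_ isT).
by have := H j; rewrite /= !inE eqxx orbT eq_sym (negbTE ij) => /(_ isT).
Qed.

Let xj (j : 'I_q.+1) (z : q.+1.-tuple R * q.+1.-tuple R) := tnth z.1 j.
Let bj (j : 'I_q.+1) (z : q.+1.-tuple R * q.+1.-tuple R) := tnth z.2 j - mu j 0.
Let vk k (z : q.+1.-tuple R * q.+1.-tuple R) := vquad (col_of_tuple z.1) k 0.

Let avg (h : q.+1.-tuple R * q.+1.-tuple R -> R) n w : R :=
  n%:R^-1 * \sum_(i < n) h (Z_ i w).

Let mxj j : measurable_fun setT (xj j).
Proof. exact: (measurableT_comp (measurable_tnth j)). Qed.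

Let mbj j : measurable_fun setT (bj j).
Proof.
by apply: measurable_funB => //; exact: (measurableT_comp (measurable_tnth j)).
Qed.

Let vkE k z : vk k z = (if (hpair k).1 == (hpair k).2 then 1 else 2)
    * (xj (hpair k).1 z * xj (hpair k).2 z).
Proof. by rewrite /vk vquadE !mxE. Qed.

Let mvk k : measurable_fun setT (vk k).
Proof.
rewrite (funext (vkE k)); apply: measurable_funM => //; exact: measurable_funM.
Qed.

Lemma average_rate h : measurable_fun setT h -> square_integrable P (h \o Z) ->
  stoch_bounded P (fun n w => Num.sqrt n%:R * (avg h n w - \int[P]_w h (Z w))).
Proof.
move=> mh h2; exact: iid_average_bounded mZ mZ_ hlaw indep_seq_pair mh h2.
Qed.

Lemma average_bounded h : measurable_fun setT h -> square_integrable P (h \o Z) ->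
  stoch_bounded P (avg h).
Proof.
move=> mh h2; have := stoch_bounded_sqrtn (average_rate mh h2).
move=> /stoch_boundedD/(_ (stoch_bounded_cst P (\int[P]_w h (Z w)))).
by move=> /stoch_bounded_le; apply; near=> n => w; rewrite subrK.
Unshelve. all: by end_near. Qed.

Let x8 j : P.-integrable setT (EFin \o (fun w => xj j (Z w) ^+ 8)).
Proof. exact: (finite_moment_integrable (r := 4) j (measurable_with_intercept W) hX8). Qed.

Let mxZ j : measurable_fun setT (xj j \o Z).
Proof. exact: measurableT_comp. Qed.

Let mbZ j : measurable_fun setT (bj j \o Z).
Proof. exact: measurableT_comp. Qed.

Let vxx2 k j l : square_integrable P (fun w => vk k (Z w) * (xj j (Z w) * xj l (Z w))).
Proof.
have := square_integrable_mul8 mxZ x8 (hpair k).1 (hpair k).2 j l.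
move=> /(square_integrableZ (if (hpair k).1 == (hpair k).2 then 1 else 2)).
congr (square_integrable _ _); apply/funext => w; rewrite vkE /=; ring.
Qed.

Let vv2 k l : square_integrable P (fun w => vk k (Z w) * vk l (Z w)).
Proof.
have := vxx2 k (hpair l).1 (hpair l).2.
move=> /(square_integrableZ (if (hpair l).1 == (hpair l).2 then 1 else 2)).
congr (square_integrable _ _); apply/funext => w; rewrite [vk l _]vkE /=; ring.
Qed.

Let b4 j : P.-integrable setT (EFin \o (fun w => bj j (Z w) ^+ 4)).
Proof.
have a4 := finite_moment_integrable (r := 2) j (measurable_funPT A) hA4.
have c4 := finite_measure_integrable_cst P (mu j 0 ^+ 4) measurableT.
apply: (integrable_le _ _ (integrableZl measurableT 8 (integrableD measurableT a4 c4))).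
  by apply: measurable_funX; exact: mbZ.
move=> w /=; rewrite /bj/=; move: (tnth _ _) (mu j 0) => a m.
rewrite ger0_norm; last by rewrite -[4%N]/(2 * 2)%N exprM sqr_ge0.
have E x : x ^+ 4 = (x ^+ 2) ^+ 2 :> R by rewrite -exprM.
rewrite !E; have h1 : (a - m) ^+ 2 <= 2 * (a ^+ 2 + m ^+ 2).
  by have := sqr_ge0 (a + m); lra.
have := sqr_ge0 (a - m); have := sqr_ge0 (a ^+ 2 - m ^+ 2).
move: h1; move: ((a - m) ^+ 2) (a ^+ 2) (m ^+ 2) => x y z; nra.
Qed.

Let b2 j : square_integrable P (fun w => bj j (Z w)).
Proof. exact: integrable4_square (mbZ j) (b4 j). Qed.

Let bb2 j l : square_integrable P (fun w => bj j (Z w) * bj l (Z w) - Sig j l).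
Proof.
exact: (square_integrableD (square_integrable_mul4 (mbZ j) (mbZ l) (b4 j) (b4 l))
  (square_integrable_cst P (- Sig j l))).
Qed.

Let A1 j : P.-integrable setT (EFin \o (fun w => tnth (A w) j)).
Proof.
have := square_integrable_L1 (square_integrableD (b2 j) (square_integrable_cst P (mu j 0))).
by apply: eq_integrable => // w _ /=; rewrite /bj subrK.
Qed.

Let Eb j : \int[P]_w bj j (Z w) = 0.
Proof.
have iA := A1 j; rewrite RintegralB//; last first.
  exact: (finite_measure_integrable_cst P (mu j 0) measurableT).
rewrite Rintegral_cst// (_ : fine (P _) = 1) ?mulr1; last first.
  exact: (congr1 fine (probability_setT P)).
by rewrite /mu mxE unlock subrr.
Qed.

Let Ebb j l : \int[P]_w (bj j (Z w) * bj l (Z w) - Sig j l) = 0.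
Proof.
rewrite RintegralB//; last 2 first.
- exact: square_integrable_mul (b2 j) (b2 l).
- exact: (finite_measure_integrable_cst P (Sig j l) measurableT).
rewrite Rintegral_cst// (_ : fine (P setT) = 1) ?mulr1; last first.
  exact: (congr1 fine (probability_setT P)).
by rewrite /Sig mxE unlock /bj /mu !mxE unlock subrr.
Qed.

(** Independence turns the fourth moments of the coefficients and the eighth
    moments of the design, taken separately, into second moments of the
    product. *)
Lemma design_coefficient_indep (phi psi : q.+1.-tuple R -> R) :
  measurable_fun setT phi -> measurable_fun setT psi ->
  square_integrable P (fun w => phi (with_intercept (W w))) ->
  square_integrable P (fun w => psi (A w)) ->
  \int[P]_w psi (A w) = 0 ->
  square_integrable P (fun w => phi (with_intercept (W w)) * psi (A w)) /\
  \int[P]_w (phi (with_intercept (W w)) * psi (A w)) = 0.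
Proof.
move=> mphi mpsi p2 s2 s0.
have [_ ->] := indep2_Rintegral p2.1 s2.1 (indep2_comp mphi mpsi hXA)
  (square_integrable_L1 p2) (square_integrable_L1 s2).
rewrite s0 mulr0; split => //; split; first exact: measurable_funM p2.1 s2.1.
have mp2 : measurable_fun setT (fun x => phi x ^+ 2) by exact: measurable_funX.
have ms2 : measurable_fun setT (fun x => psi x ^+ 2) by exact: measurable_funX.
have [+ _] := indep2_Rintegral (measurable_funX 2 p2.1) (measurable_funX 2 s2.1)
  (indep2_comp mp2 ms2 hXA) p2.2 s2.2.
by apply: eq_integrable => // w _ /=; rewrite exprMn.
Qed.

Let noise k j l z := vk k z * (xj j z * xj l z) * (bj j z * bj l z - Sig j l).
Let cross k j l m z := vk k z * (xj j z * xj l z) * bj m z.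

Let mpsi j : measurable_fun setT (fun a : q.+1.-tuple R => tnth a j - mu j 0).
Proof. by apply: measurable_funB => //; exact: measurable_tnth. Qed.

Let mphi k j l : measurable_fun setT (fun x : q.+1.-tuple R =>
  vquad (col_of_tuple x) k 0 * (tnth x j * tnth x l)).
Proof.
apply: measurable_funM; last by apply: measurable_funM; exact: measurable_tnth.
rewrite (_ : (fun _ => _) = (fun x => (if (hpair k).1 == (hpair k).2 then 1 else 2)
    * (tnth x (hpair k).1 * tnth x (hpair k).2))).
  by apply: measurable_funM => //; apply: measurable_funM; exact: measurable_tnth.
by apply/funext => x; rewrite vquadE !mxE.
Qed.

(** The factor in the coefficients is centred because Sig is their covariance
    matrix. *)
Lemma noise_rate k j l :
  stoch_bounded P (fun n w => Num.sqrt n%:R * avg (noise k j l) n w).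
Proof.
have mbb : measurable_fun setT (fun a : q.+1.-tuple R =>
    (tnth a j - mu j 0) * (tnth a l - mu l 0) - Sig j l).
  by apply: measurable_funB => //; apply: measurable_funM; exact: mpsi.
have [n2 n0] := design_coefficient_indep (mphi k j l) mbb (vxx2 k j l) (bb2 j l) (Ebb j l).
have mn : measurable_fun setT (noise k j l).
  apply: measurable_funM.
    by apply: measurable_funM => //; exact: measurable_funM.
  by apply: measurable_funB => //; exact: measurable_funM.
have := average_rate mn n2; rewrite [\int[P]_w _]n0.
by move=> /stoch_bounded_le; apply; near=> n => w; rewrite subr0.
Unshelve. all: by end_near. Qed.

Lemma cross_bounded k j l m : stoch_bounded P (avg (cross k j l m)).
Proof.
have [n2 n0] := design_coefficient_indep (mphi k j l) (mpsi m) (vxx2 k j l) (b2 m) (Eb m).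
apply: average_bounded n2.
apply: measurable_funM => //; apply: measurable_funM => //; exact: measurable_funM.
Qed.

Lemma cov_mx_sym : Sig^T = Sig.
Proof. by apply/matrixP => j l; rewrite !mxE covarianceC. Qed.

Lemma gram_rate k l : stoch_bounded P (fun n w => Num.sqrt n%:R *
  (sample_gram (sample W_ A_ n w) k l
   - vquad_gram P (fun w => with_intercept (W w)) k l)).
Proof.
have mvv : measurable_fun setT (fun z => vk k z * vk l z) by exact: measurable_funM.
apply: (stoch_bounded_le (average_rate mvv (vv2 k l))); near=> n => w.
rewrite sample_gramE /avg mxE expectation.unlock.
by under eq_bigr do rewrite tnth_mktuple.
Unshelve. all: by end_near. Qed.

Lemma sample_score_expansion n w (m : 'cV[R]_q.+1) k :
  sample_score (sample W_ A_ n w) m (vech Sig) k 0 = \sum_j \sum_l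
    (avg (noise k j l) n w - (m l 0 - mu l 0) * avg (cross k j l j) n w
     - (m j 0 - mu j 0) * avg (cross k j l l) n w
     + (m j 0 - mu j 0) * (m l 0 - mu l 0) *
       avg (fun z => vk k z * (xj j z * xj l z)) n w).
Proof.
rewrite sample_scoreE.
transitivity (n%:R^-1 * \sum_(i < n) \sum_j \sum_l
   (noise k j l (Z_ i w) - (m l 0 - mu l 0) * cross k j l j (Z_ i w)
    - (m j 0 - mu j 0) * cross k j l l (Z_ i w)
    + (m j 0 - mu j 0) * (m l 0 - mu l 0) *
       (vk k (Z_ i w) * (xj j (Z_ i w) * xj l (Z_ i w))))).
  congr (_ * _); apply: eq_bigr => i _; rewrite tnth_mktuple vquad_vech ?cov_mx_sym//=.
  have -> : response (W_ i) (A_ i) w - ((covariates (W_ i w))^T *m m) 0 0 =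
      \sum_j xj j (Z_ i w) * (bj j (Z_ i w) - (m j 0 - mu j 0)).
    have dotE (v : 'cV[R]_q.+1) : ((covariates (W_ i w))^T *m v) 0 0 =
        \sum_j xj j (Z_ i w) * v j 0.
      by rewrite mxE; apply: eq_bigr => j _; rewrite !mxE.
    rewrite /response !dotE -sumrB; apply: eq_bigr => j _.
    rewrite mxE /bj /=; ring.
  have -> : \sum_j \sum_l covariates (W_ i w) j 0 * covariates (W_ i w) l 0 * Sig j l =
      \sum_j \sum_l xj j (Z_ i w) * xj l (Z_ i w) * Sig j l.
    by apply: eq_bigr => j _; apply: eq_bigr => l _; rewrite !mxE.
  rewrite residual_expansion mulr_sumr; apply: eq_bigr => j _.
  rewrite mulr_sumr; apply: eq_bigr => l _.
  rewrite /noise /cross /vk /covariates /=; ring.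
rewrite exchange_big mulr_sumr; apply: eq_bigr => j _.
rewrite exchange_big mulr_sumr; apply: eq_bigr => l _.
rewrite /avg !(big_split, sumrN)/= -!mulr_sumr; ring.
Qed.

(** The cross and quadratic terms carry at least one factor that is the error
    of the mean estimator; it takes up sqrt n. *)
Lemma score_rate (mhat : nat -> T -> 'cV[R]_q.+1) :
  (forall j, stoch_bounded P (fun n w => Num.sqrt n%:R * (mhat n w j 0 - mu j 0))) ->
  forall k, stoch_bounded P (fun n w => Num.sqrt n%:R *
    sample_score (sample W_ A_ n w) (mhat n w) (vech Sig) k 0).
Proof.
move=> bm k; pose dl j n w := mhat n w j 0 - mu j 0.
have bdl j : stoch_bounded P (dl j) by exact: stoch_bounded_sqrtn (bm j).
have bx j l : stoch_bounded P (avg (fun z => vk k z * (xj j z * xj l z))).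
  apply: average_bounded (vxx2 k j l).
  by apply: measurable_funM => //; exact: measurable_funM.
have neg1 := stoch_bounded_cst P (-1).
pose F j l n w := Num.sqrt n%:R * avg (noise k j l) n w
  + -1 * (Num.sqrt n%:R * dl l n w * avg (cross k j l j) n w)
  + -1 * (Num.sqrt n%:R * dl j n w * avg (cross k j l l) n w)
  + Num.sqrt n%:R * dl j n w * (dl l n w * avg (fun z => vk k z * (xj j z * xj l z)) n w).
have bF j l : stoch_bounded P (F j l).
  apply: stoch_boundedD; last first.
    apply: stoch_boundedM; first exact: bm.
    by apply: stoch_boundedM; [exact: bdl|exact: bx].
  apply: stoch_boundedD; last first.
    apply: stoch_boundedM => //; apply: stoch_boundedM; first exact: bm.
    exact: cross_bounded.
  apply: stoch_boundedD; last first.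
    apply: stoch_boundedM => //; apply: stoch_boundedM; first exact: bm.
    exact: cross_bounded.
  exact: noise_rate.
apply: (stoch_bounded_le (stoch_bounded_sum _ (fun j => stoch_bounded_sum _ (bF j)))).
near=> n => w; rewrite sample_score_expansion mulr_sumr.
under eq_bigr do rewrite mulr_sumr.
rewrite le_eqVlt; apply/orP; left; apply/eqP; congr (`|_|).
apply: eq_bigr => j _; apply: eq_bigr => l _; rewrite /F /dl; ring.
Unshelve. all: by end_near. Qed.

Lemma measurable_sample n : measurable_fun setT (sample W_ A_ n).
Proof.
apply/measurable_fun_tnthP => i.
rewrite (_ : _ \o _ = (fun w => (response (W_ i) (A_ i) w, W_ i w))); last first.
  by apply/funext => w /=; rewrite tnth_mktuple.
apply: measurable_fun_pair; last exact: measurable_funPT.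
rewrite (_ : response _ _ = (fun w => \sum_j xj j (Z_ i w) * tnth (Z_ i w).2 j)).
  apply: measurable_sum => j; apply: measurable_funM.
    exact: (measurableT_comp (mxj j) (mZ_ i)).
  by apply: (measurableT_comp (measurable_tnth j)); exact: measurable_funPT.
by apply/funext => w; rewrite /response !mxE; apply: eq_bigr => j _; rewrite !mxE.
Qed.

End ModelRates.

(** * Equality of the two estimators *)

Lemma ler_norm_sum1 {R : realType} (I : finType) (f : I -> R) k :
  `|f k| <= \sum_i `|f i|.
Proof. by rewrite (bigD1 k)//= lerDl sumr_ge0. Qed.

Lemma ler_norm_sum2 {R : realType} (I J : finType) (f : I -> J -> R) k l :
  `|f k l| <= \sum_i \sum_j `|f i j|.
Proof.
rewrite (le_trans (ler_norm_sum1 (f k) l))// [leRHS](bigD1 k)//= lerDl.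
by apply: sumr_ge0 => i _; exact: sumr_ge0.
Qed.

Lemma measurable_cV_eq {R : realType} {d} {T : measurableType d} (D : nat)
    (f g : T -> 'cV[R]_D) :
  (forall k, measurable_fun setT (fun w => f w k 0)) ->
  (forall k, measurable_fun setT (fun w => g w k 0)) ->
  measurable [set w | f w = g w].
Proof.
move=> mf mg.
have -> : [set w | f w = g w] = \bigcap_(k in [set: 'I_D]) [set w | f w k 0 == g w k 0].
  apply/seteqP; split=> [w fg k _|w fg]; first by rewrite /= (fg : f w = g w).
  by apply/matrixP => k c; rewrite ord1; apply/eqP; exact: fg.
apply: fin_bigcap_measurable; first exact: finite_finset.
by move=> k _; apply: measurable_bool_set; exact: measurable_fun_eqr.
Qed.

(** It suffices that, for each bound on a stochastically bounded sequence, the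
    events eventually contain the set where that bound holds. *)
Lemma stoch_bounded_cvg1 {R : realType} {d} {T : measurableType d}
    (P : probability T R) (D : nat -> T -> R) (E : nat -> set T) :
  (forall n, measurable (E n)) -> stoch_bounded P D ->
  (forall M, 0 <= M -> \forall n \near \oo, forall w, `|D n w| <= M -> E n w) ->
  P (E n) @[n --> \oo] --> 1%E.
Proof.
move=> mE bD DE; apply/fine_cvgP; split.
  by near=> n; exact: fin_num_measure.
apply/cvgrPdist_le => eps eps0; have [M DM] := bD _ eps0.
have := DE `|M| (normr_ge0 M) => {}DE.
near=> n.
have [F [mF PF FD]] : exists F : set T, [/\ measurable F, (P (~` F) <= eps%:E)%E &
    forall w, F w -> `|D n w| <= M] by near: n.
have FE : ~` E n `<=` ~` F.
  apply: subsetC => w Fw.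
  have : forall w, `|D n w| <= `|M| -> E n w by near: n.
  by apply; rewrite (le_trans (FD w Fw))// ler_norm.
have PE1 : (P (E n) <= 1)%E by exact: probability_le1.
have PEfin : P (E n) \is a fin_num by exact: fin_num_measure.
have : (P (~` E n) <= eps%:E)%E.
  by apply: le_trans PF; apply: le_measure; rewrite ?inE//; exact: measurableC.
rewrite probability_setC// -(fineK PEfin) -EFinB lee_fin => PEeps.
rewrite ger0_norm// subr_ge0.
by rewrite -(fineK PEfin) lee_fin in PE1.
Unshelve. all: by end_near. Qed.

Theorem corollary9
  (R : realType) (disp : measure_display) (T : measurableType disp)
  (P : probability T R)
  (q : nat)
  (* the generic pair and the sample; X = (1, W^T)^T has dimension p = q.+1 *)
  (W : {RV P >-> q.-tuple R}) (A : {RV P >-> q.+1.-tuple R})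
  (W_ : nat -> {RV P >-> q.-tuple R}) (A_ : nat -> {RV P >-> q.+1.-tuple R})
  (hindep : indep_seq P (fun i w => (with_intercept (W_ i w), A_ i w)))
  (hlaw : forall i, same_law P
     (fun w => (with_intercept (W_ i w), A_ i w))
     (fun w => (with_intercept (W w), A w)))
  (hXA : indep2 P (fun w => with_intercept (W w)) A)
  (hA4 : finite_moment P 4 A)
  (hX8 : finite_moment P 8 (fun w => with_intercept (W w)))
  (hC : pdmx (vquad_gram P (fun w => with_intercept (W w))))
  (muhat : forall n, n.-tuple (obs R q) -> 'cV[R]_q.+1)
  (init AL ALpos : forall n, n.-tuple (obs R q) -> 'cV[R]_(hdim q.+1))
  (lam : nat -> R)
  (mmuhat : measurable_estimator muhat)
  (minit : measurable_estimator init)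
  (mAL : measurable_estimator AL)
  (mALpos : measurable_estimator ALpos)
  (hmuhat : bounded_in_prob P (fun n w =>
     Num.sqrt n%:R *: (muhat n (sample W_ A_ n w) - mean_vec P A)))
  (hinit : bounded_in_prob P (fun n w =>
     Num.sqrt n%:R *: (init n (sample W_ A_ n w) - vech (cov_mx P A))))
  (lam_gt0 : forall n, (0 < n)%N -> 0 < lam n)
  (lam_to0 : lam n @[n --> \oo] --> 0)
  (sqrt_lam_to0 : Num.sqrt n%:R * lam n @[n --> \oo] --> 0)
  (n_lam_toy : n%:R * lam n @[n --> \oo] --> +oo)
  (hAL : forall n (s : n.-tuple (obs R q)), (0 < n)%N ->
     adaptive_lasso s (muhat n s) (init n s) (lam n) (AL n s))
  (hALpos : forall n (s : n.-tuple (obs R q)), (0 < n)%N ->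
     adaptive_lasso_psd s (muhat n s) (init n s) (lam n) (ALpos n s))
  (d e : nat) (hde : (d + e)%N = q.+1) (Sigma1 : 'M[R]_d)
  (hSigma1 : pdmx Sigma1)
  (hSigma : cov_mx P A = castmx (hde, hde) (block_mx Sigma1 0 0 0)) :
  P [set w | ALpos n (sample W_ A_ n w) = AL n (sample W_ A_ n w)]
    @[n --> \oo] --> 1%E.
Proof.
have symS := cov_mx_sym A; set S := cov_mx P A in symS hinit hSigma *.
have [kappa kappa0 nbhsS] := block_psd_nbhs hSigma1 hSigma.
set C := vquad_gram P _ in hC.
have [c0 c00 coercC] := pdmx_coercive hC.
pose g0 := \sum_k \sum_l `|C k l|.
have Cg k l : `|C k l| <= g0.
  exact: ler_norm_sum2.
have g00 : 0 <= g0 by apply: sumr_ge0 => k _; exact: sumr_ge0.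
(* 1 / tau0 is a positive lower bound for the non-zero |sigma_k|. *)
pose tau0 := 1 + \sum_k `|(vech S k 0)^-1|.
have tau00 : 0 < tau0 by rewrite ltr_pwDl// sumr_ge0.
have tauS k : vech S k 0 != 0 -> 1 <= tau0 * `|vech S k 0|.
  move=> Sk; rewrite -ler_pdivrMr ?normr_gt0// mul1r -normfV.
  rewrite (le_trans (ler_norm_sum1 (fun k => (vech S k 0)^-1) k))//.
  by rewrite /tau0 lerDr.
have msample n := measurable_sample W_ A_ n.
have mest m (f : forall n, n.-tuple (obs R q) -> 'cV[R]_m) n k :
    measurable_estimator f -> measurable_fun setT (fun w => f n (sample W_ A_ n w) k 0).
  by move=> mf; exact: (measurableT_comp (mf n k) (msample n)).
have root_rate m (f : forall n, n.-tuple (obs R q) -> 'cV[R]_m) (c : 'cV[R]_m) :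
    measurable_estimator f -> bounded_in_prob P (fun n w =>
      Num.sqrt n%:R *: (f n (sample W_ A_ n w) - c)) ->
    forall k, stoch_bounded P (fun n w => Num.sqrt n%:R *
      (f n (sample W_ A_ n w) k 0 - c k 0)).
  move=> mf /stoch_bounded_coord bf k.
  have entryE n w j : (Num.sqrt n%:R *: (f n (sample W_ A_ n w) - c)) j 0 =
      Num.sqrt n%:R * (f n (sample W_ A_ n w) j 0 - c j 0) by rewrite !mxE.
  apply: (stoch_bounded_le (bf k _)) => [n j|].
    rewrite (funext (fun w => entryE n w j)); apply: measurable_funM => //.
    by apply: measurable_funB => //; exact: mest.
  by near=> n => w; rewrite entryE.
have bmu := root_rate _ _ _ mmuhat hmuhat.
have binit := root_rate _ _ _ minit hinit.
have bgram := gram_rate hindep hlaw hX8.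
have bscore := score_rate hindep hlaw hXA hA4 hX8 bmu.
(* One sequence controls all entries of all three errors, scaled by sqrt n. *)
pose DG n w := \sum_k \sum_l
  `|Num.sqrt n%:R * (sample_gram (sample W_ A_ n w) k l - C k l)|.
pose Dz n w := \sum_k `|Num.sqrt n%:R * sample_score (sample W_ A_ n w)
  (muhat n (sample W_ A_ n w)) (vech S) k 0|.
pose Di n w := \sum_k
  `|Num.sqrt n%:R * (init n (sample W_ A_ n w) k 0 - vech S k 0)|.
pose D n w := DG n w + Dz n w + Di n w.
have bD : stoch_bounded P D.
  apply: stoch_boundedD; last first.
    by apply: stoch_bounded_sum => k; exact: stoch_bounded_norm (binit k).
  apply: stoch_boundedD; last first.
    by apply: stoch_bounded_sum => k; exact: stoch_bounded_norm (bscore k).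
  apply: stoch_bounded_sum => k; apply: stoch_bounded_sum => l.
  exact: stoch_bounded_norm (bgram k l).
apply: (stoch_bounded_cvg1 _ bD) => [n|M M0].
  by apply: measurable_cV_eq => k; exact: mest.
have := eventually_rates c00 g00 kappa0 tau00 M0 sqrt_lam_to0 n_lam_toy.
apply: filterS => n /= [].
set eps := M / _; set L := 2 * _ / _.
move=> [n0 epsc epstau epsM Lkappa] small w DM.
have r0 : 0 < Num.sqrt n%:R :> R by rewrite sqrtr_gt0 ltr0n.
set s := sample W_ A_ n w.
have eps0 : 0 <= eps by rewrite /eps divr_ge0// ltW.
have DG0 : 0 <= DG n w by apply: sumr_ge0 => k _; exact: sumr_ge0.
have Dz0 : 0 <= Dz n w by exact: sumr_ge0.
have Di0 : 0 <= Di n w by exact: sumr_ge0.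
have DM' : D n w <= M by exact: le_trans (ler_norm _) DM.
have leD x : `|Num.sqrt n%:R * x| <= D n w -> `|x| <= eps.
  move=> xD; rewrite /eps ler_pdivlMr// mulrC.
  rewrite -[X in X * _](ger0_norm (ltW r0)) -normrM.
  exact: le_trans xD DM'.
have GC k l : `|sample_gram s k l - C k l| <= eps.
  apply: leD; rewrite /D.
  have := ler_norm_sum2 (fun k l => Num.sqrt n%:R * (sample_gram s k l - C k l)) k l.
  rewrite -/(DG n w); lra.
have zle k : `|sample_score s (muhat n s) (vech S) k 0| <= eps.
  apply: leD; rewrite /D.
  have := ler_norm_sum1 (fun k => Num.sqrt n%:R *
    sample_score s (muhat n s) (vech S) k 0) k.
  rewrite -/(Dz n w); lra.
have ile k : `|init n s k 0 - vech S k 0| <= eps.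
  apply: leD; rewrite /D.
  have := ler_norm_sum1 (fun k => Num.sqrt n%:R * (init n s k 0 - vech S k 0)) k.
  rewrite -/(Di n w); lra.
(* The Gram matrix keeps half of the coercivity of C, and the initial
   estimator of an active coordinate half of its size. *)
apply: (adaptive_lasso_psd_eq (c := c0 / 2) (g := g0 + M) (zeta := eps)
  (tau := 2 * tau0) (iota := eps) (L := L) symS (lam_gt0 n n0) _ _ eps0 _ _ zle
  _ _ (lexx _) small _ (hAL n s n0) (hALpos n s n0)).
- by rewrite divr_gt0.
- by rewrite mulr_ge0// ltW.
- move=> u; rewrite -[sample_gram s](subrK C) mulmxDr mulmxDl.
  have addE (X Y : 'M[R]_1) : (X + Y) 0 0 = X 0 0 + Y 0 0 by rewrite mxE.
  have GC' k l : `|(sample_gram s - C) k l| <= eps by have := GC k l; rewrite !mxE.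
  rewrite addE; have := coercC u; have := quad_le u GC'.
  rewrite ler_norml => /andP[+ _]; have := sqr_ge0 (l1norm u).
  move: (l1norm u ^+ 2) (_ *m u) (_ *m u) => x y z; nra.
- move=> k l; rewrite -[sample_gram s k l](subrK (C k l)).
  rewrite (le_trans (ler_normD _ _))// addrC lerD//.
  exact: le_trans (GC k l) epsM.
- move=> k /tauS; have := ile k; have := ler_normB (init n s k 0) (init n s k 0 - vech S k 0).
  rewrite subKr; move: `|vech S k 0| `|init n s k 0| `| _ - _ | => x y z; nra.
- by move=> k Sk; have := ile k; rewrite Sk subr0.
- move=> M' symM MS0 MS; apply: nbhsS => // i j; exact: le_trans (MS i j) Lkappa.
Unshelve. all: by end_near. Qed.
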